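(* Let $E:\{0,1\}^k\times\{0,1\}^d\to\{0,1\}^d$ be a PRP generator, i.e. $E_s=E(s,\cdot)$ is a permutation of $\{0,1\}^d$ for each $s$. Let $F$ be the PRF generator obtained by the xor construction: $F_{(s_1,s_2)}(x)=E_{s_1}(x)\oplus E_{s_2}(x)$ with keys $(s_1,s_2)\in\{0,1\}^k\times\{0,1\}^k$. Then for every $m<2^d$, \[ \mathrm{Adv}_F^{\mathrm{PRF}}(m)\le 2\,\mathrm{Adv}_E^{\mathrm{PRP}}(m)+O(m/2^{3d/2}), \] with an absolute implied constant.
   Context: $\oplus$ is bitwise xor, i.e. addition in $\mathbf{F}_2^d\cong\{0,1\}^d$. A distinguisher $A$ is a probabilistic algorithm that is given oracle access to a function $g:\{0,1\}^d\to\{0,1\}^d$, may query values $g(x)$ adaptively (query points may depend on previous answers), and outputs $A(g)\in\{0,1\}$; no computational restriction is imposed other than the number of queries. For a keyed family $F$ with key space $K$, $\mathrm{Adv}_F^{\mathrm{PRF}}(A)=|\mathbb P(A(F_s)=1)-\mathbb P(A(f)=1)|$ with $s$ uniform in $K$ and $f$ a uniformly random function $\{0,1\}^d\to\{0,1\}^d$; $\mathrm{Adv}_E^{\mathrm{PRP}}(A)=|\mathbb P(A(E_s)=1)-\mathbb P(A(\pi)=1)|$ with $s$ uniform in $\{0,1\}^k$ and $\pi$ a uniformly random permutation of $\{0,1\}^d$. Finally $\mathrm{Adv}^{\mathrm{PRF}}_F(m)$ (resp. $\mathrm{Adv}^{\mathrm{PRP}}_E(m)$) is the maximum of $\mathrm{Adv}^{\mathrm{PRF}}_F(A)$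 (resp. $\mathrm{Adv}^{\mathrm{PRP}}_E(A)$) over all distinguishers $A$ making at most $m$ queries. *)

(* Defs.v *)
From Stdlib Require Import Rdefinitions.
From HB Require Import structures.
From mathcomp Require Import all_boot all_order all_algebra all_fingroup.
From mathcomp Require Import classical_sets boolp reals Rstruct.
Set Implicit Arguments. Unset Strict Implicit. Unset Printing Implicit Defensive.
Import Order.TTheory GRing.Theory Num.Theory.
Local Open Scope ring_scope.

(* bit strings {0,1}^n = F_2^n; xor = addition *)
Definition bits (n : nat) := 'rV['F_2]_n.

(* Deterministic adaptive query strategy over domain D:
   either output a bit, or query g(x) and continue depending on the answer. *)
Inductive qtree (D : Type) : Type :=
| Leaf of bool
| Query of D & (D -> qtree D).
Arguments Leaf {D}.

Fixpoint run (D : Type) (t : qtree D) (g : D -> D) : bool :=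
  match t with
  | Leaf b => b
  | Query x k => run (k (g x)) g
  end.

Fixpoint at_most_queries (D : Type) (m : nat) (t : qtree D) : Prop :=
  match t with
  | Leaf _ => True
  | Query _ k =>
      match m with
      | 0 => False
      | m'.+1 => forall y, at_most_queries m' (k y)
      end
  end.

(* A probabilistic distinguisher: a random tape omega drawn with probability
   weights mu, and for each tape a deterministic adaptive query strategy. *)
Record distinguisher (D : Type) := Distinguisher {
  tape : finType;
  mu : tape -> R;
  strat : tape -> qtree D }.
Arguments tape {D} d.
Arguments mu {D} d w.
Arguments strat {D} d w.

Definition valid_dist (D : Type) (m : nat) (A : distinguisher D) : Prop :=
  (forall w, 0 <= mu A w) /\ (\sum_(w : tape A) mu A w = 1) /\
  (forall w, at_most_queries m (strat A w)).

Definition accP (D : Type) (A : distinguisher D) (g : D -> D) : R :=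
  \sum_(w : tape A) mu A w * (run (strat A w) g)%:R.

Definition avg (T : finType) (f : T -> R) : R :=
  (\sum_(t : T) f t) / #|T|%:R.

Definition advPRF (K D : finType) (F : K -> D -> D) (A : distinguisher D) : R :=
  `| avg (fun s : K => accP A (F s)) - avg (fun f : {ffun D -> D} => accP A f) |.

Definition advPRP (K D : finType) (E : K -> D -> D) (A : distinguisher D) : R :=
  `| avg (fun s : K => accP A (E s)) - avg (fun p : {perm D} => accP A p) |.

Definition AdvPRF (K D : finType) (F : K -> D -> D) (m : nat) : R :=
  sup [set a | exists A : distinguisher D, valid_dist m A /\ a = advPRF F A].

Definition AdvPRP (K D : finType) (E : K -> D -> D) (m : nat) : R :=
  sup [set a | exists A : distinguisher D, valid_dist m A /\ a = advPRP E A].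

Definition xorF (k d : nat) (E : bits k -> bits d -> bits d)
  (s : bits k * bits k) (x : bits d) : bits d := E s.1 x + E s.2 x.

(* Main.v *)
(* Replacing E_{s1} and then E_{s2} by random permutations costs twice the PRP advantage, so it remains
   to compare p + r, for independent random permutations p and r, with a random function.  The law
   of p + r is invariant under relabelling the query points, so adaptivity does not help, and by
   Cauchy-Schwarz and Parseval the squared advantage on a query set Q of size m is at most the sum
   of fhat(psi)^4 over nonzero characters psi supported in Q, where fhat is the Fourier transform of
   the uniform measure on permutations.  Averaging over Q and using invariance under adding a
   constant character reduces the claim to the bound O(1/N), N = 2^d, for the sum Z of fhat(psi)^4
   over nonzero psi whose most frequent value is 0.

   Let k be the size of the support of psi.  Averaging over one coordinate expresses fhat(psi) through
   coefficients of levels k-1 and k-2, which gives C(N,k) fhat(psi)^2 <= 1 for k <= N/2; the total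
   mass of fhat^2 at level k is C(N,k) W_k with (N-k) W_{k+1} = k (2 W_k + W_{k-1}), and it is at
   most 2^(k-N) e^N.  This controls the levels k <= N/2.  For k > N/2, extracting a coefficient of
   prod_x (sum_a z_a chi_a(x)) by averaging over phases of z and applying AM-GM gives fhat(psi)^2 <=
   prod_a u(n_a) / u(N), where n_a are the multiplicities of the values of psi and u(n) = n!^2 / n^n
   is log-convex; all n_a are at most N - k < N/2, and together with the mass bound this is
   exponentially small. *)
Require Import Defs.
From Stdlib Require Import Rdefinitions.
From mathcomp Require Import classical_sets boolp reals Rstruct.
From mathcomp Require Import all_boot all_order all_algebra all_fingroup all_field.
From mathcomp Require Import zify ring lra.
Set Implicit Arguments. Unset Strict Implicit. Unset Printing Implicit Defensive.
Import Order.TTheory GRing.Theory Num.Theory.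
Local Open Scope ring_scope.

(** * Log-convex sequences and factorial estimates *)

Lemma bin_central_lower n : (4 ^ n <= 'C(n.*2, n) * n.*2.+1)%N.
Proof.
elim: n => [//|n IH].
have e1 := mul_bin_diag n.*2.+2 n.
have e2 := mul_bin_down n.*2.+1 n.
have e3 : (n.+1 * 'C(n.*2.+2, n.+1) = 2 * (n.*2.+1 * 'C(n.*2, n)))%N.
  rewrite -e1 /= in e2 *; rewrite e2; have -> : (n.*2.+1 - n = n.+1)%N by lia.
  lia.
rewrite doubleS expnS -(leq_pmul2l (ltn0Sn n)).
have -> : (n.+1 * ('C(n.*2.+2, n.+1) * n.*2.+3) =
  2 * n.*2.+3 * ('C(n.*2, n) * n.*2.+1))%N by rewrite mulnA e3; lia.
have : (n.+1 * 4 <= 2 * n.*2.+3)%N by lia.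
by move=> h; rewrite mulnA leq_mul.
Qed.

(** The exponential growth rate of these coefficients is 256/27, a little above 9, so the ratio of
    consecutive terms suffices for an induction. Any rate above 60/8 would give exponential decay at
    level N/4. *)
Lemma bin_quarter_lower n : (9 ^ n <= 'C(4 * n, n) * (4 * n).+1)%N.
Proof.
elim: n => [//|n IH].
have e0 := @bin_fact (4 * n) n ltac:(lia).
have e1 := @bin_fact (4 * n.+1) n.+1 ltac:(lia).
have f1 : ((4 * n.+1)`! = (4 * n).+4 * (4 * n).+3 * (4 * n).+2 * (4 * n).+1 * (4 * n)`!)%N.
  have -> : (4 * n.+1 = (4 * n).+4)%N by lia.
  by rewrite !factS !mulnA.
have f2 : ((4 * n.+1 - n.+1)`! = (3 * n).+3 * (3 * n).+2 * (3 * n).+1 * (4 * n - n)`!)%N.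
  have -> : (4 * n.+1 - n.+1 = (3 * n).+3)%N by lia.
  have -> : (4 * n - n = 3 * n)%N by lia.
  by rewrite !factS !mulnA.
have e2 : ('C(4 * n.+1, n.+1) * (n.+1 * ((3 * n).+3 * (3 * n).+2 * (3 * n).+1))
   = (4 * n).+4 * (4 * n).+3 * (4 * n).+2 * (4 * n).+1 * 'C(4 * n, n))%N.
  have p0 : (0 < n`! * (4 * n - n)`!)%N by rewrite muln_gt0 !fact_gt0.
  apply/eqP; rewrite -(eqn_pmul2r p0); apply/eqP.
  by move: e1; rewrite f1 f2 factS -e0; set a := 'C(_, _); set b := 'C(_, _); lia.
have h : (n.+1 * ((3 * n).+3 * (3 * n).+2 * (3 * n).+1) * 9 <=
  (4 * n).+4 * (4 * n).+3 * (4 * n).+2 * (4 * n.+1).+1)%N.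
  have h1 : ((3 * n).+3 * (3 * n).+2 * (3 * n).+1 * 9 <=
     4 * (4 * n).+3 * (4 * n).+2 * (4 * n.+1).+1)%N.
    have -> : ((3 * n).+3 * (3 * n).+2 * (3 * n).+1 * 9 =
      243 * (n * (n * n)) + 486 * (n * n) + 297 * n + 54)%N by lia.
    have -> : (4 * (4 * n).+3 * (4 * n).+2 * (4 * n.+1).+1 =
      256 * (n * (n * n)) + 640 * (n * n) + 496 * n + 120)%N by lia.
    lia.
  have -> : ((4 * n).+4 * (4 * n).+3 * (4 * n).+2 * (4 * n.+1).+1 =
    n.+1 * (4 * (4 * n).+3 * (4 * n).+2 * (4 * n.+1).+1))%N by lia.
  by rewrite -mulnA leq_mul.
have p1 : (0 < n.+1 * ((3 * n).+3 * (3 * n).+2 * (3 * n).+1))%N by lia.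
move: e2 h p1 IH; set D := (n.+1 * _)%N; set K := (_ * (4 * n).+2)%N.
move: D K (4 * n).+1 (4 * n.+1).+1 'C(4 * n, n) 'C(4 * n.+1, n.+1) => D K x y b c e2 h p1 IH.
rewrite -(leq_pmul2l p1) expnS.
have -> : (D * (c * y) = K * y * (b * x))%N by rewrite mulnA [(D * c)%N]mulnC e2; lia.
by rewrite mulnA leq_mul.
Qed.

Section RealSequences.
Variable R : realFieldType.
Implicit Types (f : nat -> R) (c : R).

Lemma poly_mul_geometric_bound q : (4 * q).+1%:R ^+ 8 * (15 / 16) ^+ q <= 500 ^+ 8 :> R.
Proof.
(* Each increment of 4 is paid for by 500/125, the gain of one more factor 126/125; the eighth power
   of that factor stays below 16/15. *)
have b : (4 * q).+1%:R <= 500 * (126 / 125) ^+ q :> R.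
  elim: q => [|q IH]; first by rewrite muln0 expr0; lra.
  have h1 : 1 <= (126 / 125) ^+ q :> R by apply: exprn_ege1; lra.
  rewrite exprS; have -> : (4 * q.+1).+1%:R = (4 * q).+1%:R + 4 :> R by rewrite -natrD; congr (_ %:R); lia.
  lra.
have b8 : (4 * q).+1%:R ^+ 8 <= (500 * (126 / 125) ^+ q) ^+ 8 :> R.
  by apply: lerXn2r; rewrite ?nnegrE ?ler0n //; apply: mulr_ge0; [lra|apply: exprn_ge0; lra].
have g0 : 0 <= (15 / 16) ^+ q :> R by apply: exprn_ge0; lra.
apply: (le_trans (ler_wpM2r g0 b8)).
rewrite exprMn -mulrA -[leRHS]mulr1 ler_wpM2l ?exprn_ge0 //.
rewrite -exprM mulnC exprM -exprMn; apply: exprn_ile1.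
  by apply: mulr_ge0; rewrite ?exprn_ge0; lra.
have : (126 / 125) ^+ 8 <= 16 / 15 :> R by lra.
lra.
Qed.

Lemma logconvex_le_ends f c (a b : nat) :
  (forall j, (a <= j <= b)%N -> 0 < f j) ->
  (forall j, (a <= j)%N -> (j.+2 <= b)%N -> f j.+1 ^+ 2 <= f j * f j.+2) ->
  f a <= c -> f b <= c -> forall j, (a <= j <= b)%N -> f j <= c.
Proof.
move=> f0 fc fa fb j /andP[aj jb]; rewrite leNgt; apply/negP => cj.
(* past a point where f exceeds its left end, the ratios f(j+1)/f(j) stay above 1 *)
have [i [/andP[ai ij] fi]] : exists i, (a <= i < j)%N /\ f i < f i.+1.
  suff H : forall i, (a <= i <= j)%N -> (exists i, (a <= i < j)%N /\ f i < f i.+1) \/ f i <= c.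
    case: (H j); [by rewrite aj leqnn|by []|by move=> h; move: cj; rewrite ltNge h].
  elim=> [|i IH] /andP[h1 h2].
    by right; have -> : 0%N = a by lia.
  case: (ltnP i a) => ia; first by right; have -> : i.+1 = a by lia.
  case: IH => [|//|h]; [by apply/andP; split; lia|by left|].
  case: (ltP (f i) (f i.+1)) => h3; first by left; exists i; split=> //; apply/andP; split; lia.
  by right; apply: le_trans h.
have mono : forall k, (i <= k < b)%N -> f k < f k.+1.
  elim=> [|k IH] /andP[h1 h2]; first by have <- : i = 0%N by lia.
  case: (ltnP k i) => ki; first by have <- : i = k.+1 by lia.
  have h3 : f k < f k.+1 by apply: IH; apply/andP; split; lia.
  have k0 : 0 < f k by apply: f0; lia.
  have k1 : 0 < f k.+1 by apply: f0; lia.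
  have := fc k ltac:(lia) ltac:(lia).
  rewrite -(ltr_pM2l k0); apply: lt_le_trans.
  by rewrite expr2 ltr_pM2r.
have up : forall k, (j <= k <= b)%N -> f j <= f k.
  elim=> [|k IH] /andP[h1 h2]; first by have -> : j = 0%N by lia.
  case: (leqP j k) => jk; last by have -> : j = k.+1 by lia.
  apply: (le_trans (IH _)); [by apply/andP; split; lia|].
  by apply/ltW/mono; apply/andP; split; lia.
have : c < f b by apply: lt_le_trans cj (up b _); rewrite jb leqnn.
by rewrite ltNge fb.
Qed.

Lemma sum_exp_truncated_le q :
  \sum_(j < (4 * q).+1) (4 * q)%:R ^+ j / (j`!)%:R <= 60 ^+ q :> R.
Proof.
(* (1 + 1/24)^(25N) dominates the truncated exponential series of N termwise *)
have -> : \sum_(j < (4 * q).+1) (4 * q)%:R ^+ j / (j`!)%:R =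
   \sum_(0 <= j < (4 * q).+1) (4 * q)%:R ^+ j / (j`!)%:R :> R by rewrite big_mkord.
(* As e^4 < 60, the base 60 leaves room: (25/24)^10 is at most 1.505, whose tenth power is below
   60. *)
have h : (1 + 24^-1) ^+ (25 * (4 * q)) <= 60 ^+ q :> R.
  have -> : (25 * (4 * q) = 10 * (10 * q))%N by lia.
  have e10 : (1 + 24^-1) ^+ 10 <= 1505 / 1000 :> R by lra.
  rewrite exprM; apply: (@le_trans _ _ ((1505 / 1000) ^+ (10 * q))).
    by apply: lerXn2r; rewrite ?nnegrE ?exprn_ge0 //; lra.
  by rewrite exprM; apply: lerXn2r; rewrite ?nnegrE ?exprn_ge0 //; lra.
apply: le_trans h; rewrite exprDn.
rewrite -(big_mkord xpredT (fun i => 1 ^+ (25 * (4 * q) - i) * 24^-1 ^+ i *+ 'C(25 * (4 * q), i))).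
have le1 : ((4 * q).+1 <= (25 * (4 * q)).+1)%N by lia.
rewrite [leRHS](big_cat_nat (leq0n _) le1) /=.
rewrite -[leLHS]addr0; apply: lerD; last first.
  by apply: sumr_ge0 => i _; rewrite mulrn_wge0 // mulr_ge0 ?exprn_ge0 //; lra.
rewrite big_nat_cond [leRHS]big_nat_cond; apply: ler_sum => j /andP[/andP[_ jN] _].
rewrite expr1n mul1r -[_ *+ 'C(_, _)]mulr_natr ler_pdivrMr ?ltr0n ?fact_gt0 //.
rewrite -mulrA -natrM bin_ffact exprVn.
rewrite mulrC ler_pdivlMr ?exprn_gt0 //.
rewrite -!natrX -natrM ler_nat.
(* With N = 4q, every factor 25N - j of the falling factorial is at least 24N, since j stays below
   N. *)
elim: j jN => [|j IH] jN; first by rewrite ffactn0.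
rewrite ffactnSr !expnSr mulnACA; apply: leq_mul; first by apply: IH; lia.
lia.
Qed.

(** The contribution of a fiber of size n to the bound on a squared coefficient: n!^2 counts
    permutations inside the fiber and n^n comes from AM-GM. The convention 0^0 = 1 makes empty
    fibers neutral. *)
Definition ufact n : R := (n`!)%:R ^+ 2 / n%:R ^+ n.

Lemma ufact0 : ufact 0 = 1.
Proof. by rewrite /ufact expr0 divr1 expr1n. Qed.

Lemma ufact_gt0 n : 0 < ufact n.
Proof.
case: n => [|n]; first by rewrite ufact0.
by apply: divr_gt0; apply: exprn_gt0; rewrite ltr0n // fact_gt0.
Qed.

(** For positive n, cancelling the factorials leaves the n-th power of n (n + 2) <= (n + 1)^2. *)
Lemma ufact_logconvex n : ufact n.+1 ^+ 2 <= ufact n * ufact n.+2.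
Proof.
case: n => [|n].
  by rewrite ufact0 /ufact !factS fact0 !expr1; lra.
set x : R := n.+1%:R.
have x0 : 0 < x by rewrite ltr0n.
have e2 : n.+2%:R = x + 1 :> R by rewrite /x -[n.+2]addn1 natrD.
have e3 : n.+3%:R = x + 2 :> R by rewrite /x -[n.+3]addn2 natrD.
rewrite /ufact !factS !natrM e2 e3 -/x; set y : R := (n`!)%:R.
have y0 : 0 < y by rewrite ltr0n fact_gt0.
have key : (x * (x + 2)) ^+ n.+1 <= ((x + 1) ^+ 2) ^+ n.+1.
  apply: lerXn2r; rewrite ?nnegrE; nra.
rewrite exprMn -exprM mulnC exprM in key.
have A0 : 0 < x ^+ n.+1 by apply: exprn_gt0.
have B0 : 0 < (x + 1) ^+ n.+1 by apply: exprn_gt0; lra.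
have C0 : 0 < (x + 2) ^+ n.+1 by apply: exprn_gt0; lra.
rewrite !(exprSr _ n.+2) !(exprSr _ n.+1).
move: A0 B0 C0 key; set A := x ^+ n.+1; set B := (x + 1) ^+ n.+1; set C := (x + 2) ^+ n.+1.
move=> A0 B0 C0 key.
have -> : (((x + 1) * (x * y)) ^+ 2 / (B * (x + 1))) ^+ 2 =
  (x * y) ^+ 4 * (x + 1) ^+ 2 * (B ^+ 2)^-1.
  by field; apply/andP; split; apply: lt0r_neq0; lra.
have -> : (x * y) ^+ 2 / A * (((x + 2) * ((x + 1) * (x * y))) ^+ 2 / (C * (x + 2) * (x + 2))) =
  (x * y) ^+ 4 * (x + 1) ^+ 2 * (A * C)^-1.
  by field; rewrite !lt0r_neq0 //; lra.
rewrite ler_wpM2l //; first by apply: mulr_ge0; apply: exprn_ge0; nra.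
have B2 : 0 < B ^+ 2 by apply: exprn_gt0.
have AC : 0 < A * C by apply: mulr_gt0.
by rewrite lef_pV2 ?posrE.
Qed.

Lemma ufact_ratio_le m n : (m <= n)%N -> ufact m.+1 * ufact n <= ufact m * ufact n.+1.
Proof.
elim: n => [|n IH]; first by rewrite leqn0 => /eqP->; rewrite mulrC.
rewrite leq_eqVlt => /orP[/eqP->|]; first by rewrite mulrC.
rewrite ltnS => /IH h.
rewrite -(ler_pM2r (ufact_gt0 n)) -(ler_pM2r (ufact_gt0 n.+1)).
have h2 := ufact_logconvex n.
have p := ufact_gt0; have := p m; have := p m.+1; have := p n; have := p n.+1; have := p n.+2.
move: h h2; rewrite expr2.
set a := ufact m; set b := ufact m.+1; set c := ufact n; set e := ufact n.+1; set g := ufact n.+2.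
move=> h h2 g0 e0 c0 b0 a0.
have h3 : (b * c) * (e * e) <= (a * e) * (c * g) by apply: ler_pM => //; apply/ltW/mulr_gt0.
lra.
Qed.

(** The ratios of consecutive terms increase, so of two pairs with the same sum the more unequal one
    has the larger product. *)
Lemma ufact_spread m n t : (m <= n)%N -> ufact (m + t) * ufact n <= ufact m * ufact (n + t).
Proof.
move=> mn; elim: t => [|t IH]; first by rewrite !addn0.
have h := @ufact_ratio_le (m + t) (n + t) ltac:(lia).
rewrite !addnS -(ler_pM2r (ufact_gt0 (m + t))) -(ler_pM2r (ufact_gt0 (n + t))).
have p := ufact_gt0; have := p (m + t)%N; have := p (n + t)%N; have := p n; have := p m.
have := p (m + t).+1; have := p (n + t).+1.
move: h IH; set a := ufact _; set b := ufact _; set c := ufact _; set e := ufact _.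
set g := ufact _; set k := ufact _.
move=> h IH e0 a0 k0 g0 b0 c0.
have h3 : (a * b) * (c * g) <= (c * e) * (k * b) by apply: ler_pM => //; apply/ltW/mulr_gt0.
lra.
Qed.

Lemma ufact_superadd m n : ufact m * ufact n <= ufact (m + n).
Proof. by have := @ufact_spread 0 n m (leq0n _); rewrite ufact0 mul1r add0n addnC. Qed.

(** Exactly, u(2n) = u(n)^2 C(2n,n)^2 / 4^n, and the central coefficient is at least 4^n / (2n + 1).
    Splitting a part into halves thus gains 4^n up to a polynomial factor. *)
Lemma sqr_ufact_le n : ufact n ^+ 2 <= ufact n.*2 * (n.*2.+1%:R ^+ 2 / 4 ^+ n).
Proof.
have fd : (n.*2`! = 'C(n.*2, n) * (n`! * n`!))%N.
  by rewrite -(@bin_fact n.*2 n) -addnn ?leq_addr // addnK.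
have -> : ufact n.*2 = ufact n ^+ 2 * ('C(n.*2, n)%:R ^+ 2 / 4 ^+ n).
  rewrite /ufact fd !natrM; case: n {fd} => [|n]; first by rewrite double0 bin0 fact0 !expr0; field.
  have -> : n.+1.*2%:R = 2 * n.+1%:R :> R by rewrite -muln2 natrM mulrC.
  have n0 : n.+1%:R != 0 :> R by rewrite pnatr_eq0.
  have -> : (2 * n.+1%:R) ^+ n.+1.*2 = 4 ^+ n.+1 * (n.+1%:R ^+ n.+1) ^+ 2 :> R.
    have -> : 4 = 2 ^+ 2 :> R by ring.
    by rewrite -muln2 exprMn mulnC !exprM [(n.+1%:R ^+ n.+1) ^+ 2]exprAC.
  have := expf_neq0 n.+1 n0; set y := n.+1%:R ^+ n.+1 => y0.
  have : 4 ^+ n.+1 != 0 :> R by rewrite expf_neq0 // pnatr_eq0.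
  by set z := 4 ^+ n.+1 => z0; field; rewrite y0 z0.
have z0 : 0 < 4 ^+ n :> R by apply: exprn_gt0.
rewrite -mulrA -[leLHS]mulr1 ler_wpM2l ?sqr_ge0 //.
have -> : 'C(n.*2, n)%:R ^+ 2 / 4 ^+ n * (n.*2.+1%:R ^+ 2 / 4 ^+ n) =
   ('C(n.*2, n)%:R * n.*2.+1%:R / 4 ^+ n) ^+ 2 :> R by field; rewrite gt_eqF.
by rewrite exprn_ege1 // ler_pdivlMr // mul1r -natrX -natrM ler_nat bin_central_lower.
Qed.

(* Majorization: with all parts at most a, a product of log-convex factors is largest
   when as many parts as possible equal a. *)
Lemma prod_ufact_le (I : Type) (r : seq I) (F : I -> nat) a :
  (0 < a)%N -> all (fun i => F i <= a)%N r ->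
  \prod_(i <- r) ufact (F i) <=
  ufact a ^+ ((\sum_(i <- r) F i) %/ a) * ufact ((\sum_(i <- r) F i) %% a).
Proof.
move=> a0; elim: r => [|i r IH] /=; first by rewrite !big_nil div0n mod0n ufact0 mulr1.
move=> /andP[ia ra]; rewrite !big_cons.
have ui : 0 <= ufact (F i) by apply/ltW/ufact_gt0.
apply: (le_trans (ler_wpM2l ui (IH ra))); set S := (\sum_(j <- r) F j)%N.
rewrite (mulrCA _ (_ ^+ _)); set t := (S %/ a)%N; set s := (S %% a)%N.
have sa : (s < a)%N by rewrite ltn_mod.
have eS : (F i + S = t * a + (F i + s))%N by rewrite [S](divn_eq S a) -/t -/s; lia.
rewrite eS divnMDl // modnMDl exprD -mulrA ler_wpM2l //; first by apply/exprn_ge0/ltW/ufact_gt0.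
case: (ltnP (F i + s) a) => h.
  by rewrite divn_small // modn_small // expr0 mul1r ufact_superadd.
have e1 : (F i + s = 1 * a + (F i + s - a))%N by lia.
rewrite e1 divnMDl // modnMDl divn_small ?modn_small; try lia.
rewrite addn0 expr1 [leRHS]mulrC.
(* On overflow, the pair of parts [F i] and [s] is spread to a full part [a] and the remainder
   [F i + s - a]. *)
have := @ufact_spread (F i + s - a) s (a - s) ltac:(lia).
have -> : (F i + s - a + (a - s) = F i)%N by lia.
by have -> : (s + (a - s) = a)%N by lia.
Qed.

End RealSequences.

(** * Fourier coefficients of a random permutation *)

(* A self-duality of an elementary abelian 2-group; a |-> chi a runs over its characters. *)
Record char_pairing (G : finZmodType) := CharPairing {
  chi :> G -> G -> int;
  chiDl : forall a b x, chi (a + b) x = chi a x * chi b x;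
  chiDr : forall a x y, chi a (x + y) = chi a x * chi a y;
  chi_sqr : forall a x, chi a x ^+ 2 = 1;
  chi_suml : forall a, \sum_x chi a x = if a == 0 then #|G|%:R else 0;
  chi_sumr : forall x, \sum_a chi a x = if x == 0 then #|G|%:R else 0;
  char_two : forall x : G, x + x = 0 }.

Section Permanent.
Variables (G : finZmodType) (chi : char_pairing G).
Implicit Types (psi : {ffun G -> G}) (p : {perm G}) (Q A B : {set G}).

Lemma chi0l x : chi 0 x = 1.
Proof. by rewrite -(chi_sqr chi 0 x) expr2 -chiDl addr0. Qed.

Definition supp psi : {set G} := [set i | psi i != 0].

Definition bump psi i a : {ffun G -> G} := [ffun j => psi j + (if j == i then a else 0)].

(** The permanent of the matrix with entries [chi (psi i) x]. Divided by the number of permutations,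
    it is the Fourier coefficient at [psi] of the uniform law on permutations. *)
Definition per psi : int := \sum_(p : {perm G}) \prod_i chi (psi i) (p i).

Lemma card_perm_type : #|{perm G}| = (#|G| `!)%N.
Proof.
rewrite -[in RHS]cardsT -card_perm; apply: eq_card => p.
by rewrite [LHS]inE; apply/esym/subsetP => x _; apply: in_setT.
Qed.

Lemma per0 : per [ffun=> 0] = (#|G| `!)%:R.
Proof.
rewrite /per (eq_bigr (fun=> 1)) => [|p _]; last by rewrite big1 // => i _; rewrite ffunE chi0l.
by rewrite sumr_const card_perm_type.
Qed.

Lemma per_perm (s : {perm G}) psi : per [ffun i => psi (s i)] = per psi.
Proof.
rewrite /per (reindex_inj (mulgI s)) /=; apply: eq_bigr => p _.
rewrite [RHS](reindex_inj (@perm_inj _ s)) /=.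
by apply: eq_bigr => i _; rewrite ffunE permM.
Qed.

(** A permutation takes every value once, so a constant character contributes the same sign for
    every [p]. *)
Lemma per_shift c psi : per [ffun i => psi i + c] = (\prod_x chi c x) * per psi.
Proof.
rewrite /per mulr_sumr; apply: eq_bigr => p _.
rewrite [X in X * _](reindex_inj (@perm_inj _ p)) -big_split /=.
by apply: eq_bigr => i _; rewrite ffunE chiDl mulrC.
Qed.

Lemma sqr_per_shift c psi : per [ffun i => psi i + c] ^+ 2 = per psi ^+ 2.
Proof.
rewrite per_shift exprMn -prodrXl big1 ?mul1r // => x _; exact: chi_sqr.
Qed.

(** For a fixed [p], bumping at [i] multiplies the term by [chi a (p i)], and these factors sum over
    [i] to a full character sum, which vanishes. *)
Lemma sum_per_bump psi a : a != 0 -> \sum_i per (bump psi i a) = 0.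
Proof.
move=> a0; rewrite exchange_big /= big1 // => p _.
rewrite (eq_bigr (fun i => (\prod_j chi (psi j) (p j)) * chi a (p i))) => [|i _].
  have e : \sum_i chi a (p i) = \sum_x chi a x by rewrite [RHS](reindex_inj (@perm_inj _ p)).
  by rewrite -mulr_sumr e chi_suml (negbTE a0) mulr0.
rewrite (bigD1 i) //= [in RHS](bigD1 i) //= ffunE eqxx chiDl -!mulrA; congr (_ * _).
rewrite mulrC; congr (_ * _); apply: eq_bigr => j ji.
by rewrite ffunE (negbTE ji) addr0.
Qed.

(** Orthogonality, coordinate by coordinate: each point of [Q] contributes a full character sum,
    every other point the trivial character alone. *)
Lemma sum_prod_chi Q (g : G -> G) :
  \sum_(psi : {ffun G -> G} | supp psi \subset Q) \prod_i chi (psi i) (g i) =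
  if [forall i in Q, g i == 0] then #|G|%:R ^+ #|Q| else 0.
Proof.
pose S i : pred G := if i \in Q then predT else pred1 0.
rewrite (eq_bigl (fun psi : {ffun G -> G} => psi \in family S)) => [|psi]; last first.
  apply/subsetP/familyP => h i.
    by rewrite /S; case: ifP => // /negbT iQ; have := contra (h i) iQ; rewrite !inE negbK.
  by rewrite inE; have := h i; rewrite /S; case: ifP => // _; rewrite inE => /eqP->; rewrite eqxx.
rewrite -(bigA_distr_big_dep S (fun i a => chi a (g i))) /=.
have e i : \sum_(a | S i a) chi a (g i) = if i \in Q then (if g i == 0 then #|G|%:R else 0) else 1.
  by rewrite /S; case: ifP => _; rewrite ?big_pred1_eq ?chi0l // -(chi_sumr chi).
rewrite (eq_bigr _ (fun i _ => e i)) -big_mkcond /=; case: ifPn => [/'forall_implyP h|].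
  by rewrite (eq_bigr (fun=> #|G|%:R)) ?prodr_const // => i /h ->.
rewrite negb_forall => /existsP[i]; rewrite negb_imply => /andP[iQ gi].
by rewrite (bigD1 i) //= (negbTE gi) mul0r.
Qed.

Lemma card_perm_agree Q p :
  #|[set q : {perm G} | [forall i in Q, p i + q i == 0]]| = (#|G| - #|Q|)`!.
Proof.
have -> : (#|G| - #|Q| = #|~: Q|)%N by rewrite -(cardsC Q) addKn.
rewrite -(card_perm (~: Q)) -[RHS](card_imset _ (mulIg p)); apply: eq_card => q.
have ->: (q \in [set q : {perm G} | [forall i in Q, p i + q i == 0]]) =
   [forall i in Q, q i == p i].
  rewrite inE; apply: eq_forallb_in => i _.
  by rewrite -[RHS](inj_eq (addrI (p i))) (char_two chi).
apply/'forall_implyP/imsetP => [h|[s sQ ->] i iQ]; last first.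
  by rewrite permM (out_perm sQ) // inE negbK.
exists (q * p^-1)%g; last by rewrite mulgKV.
apply/subsetP => i; rewrite !inE; apply: contra => /h /eqP e.
by rewrite permM e permK.
Qed.

(** Parseval on the coordinates in [Q]: expanding the square over pairs of permutations, only the
    pairs that agree on [Q] survive. *)
Lemma sum_sqr_per Q :
  \sum_(psi | supp psi \subset Q) per psi ^+ 2 =
  #|G|%:R ^+ #|Q| * (#|G| `! * (#|G| - #|Q|)`!)%:R.
Proof.
have e psi : per psi ^+ 2 = \sum_(p : {perm G}) \sum_(q : {perm G}) \prod_i chi (psi i) (p i + q i).
  rewrite expr2 {1}/per mulr_suml; apply: eq_bigr => p _.
  rewrite mulr_sumr; apply: eq_bigr => q _; rewrite -big_split /=.
  by apply: eq_bigr => i _; rewrite chiDr.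
rewrite (eq_bigr _ (fun psi _ => e psi)) exchange_big /=.
rewrite (eq_bigr (fun=> #|G|%:R ^+ #|Q| * (#|G| - #|Q|)`!%:R)) => [|p _].
  rewrite sumr_const natrM card_perm_type.
  by rewrite -[LHS]mulr_natr -mulrA [_%:R * _%:R]mulrC.
rewrite exchange_big /= (eq_bigr _ (fun (q : {perm G}) _ => sum_prod_chi Q (fun i => p i + q i))).
rewrite -big_mkcond /= sumr_const -(card_perm_agree Q p) mulr_natr; congr (_ *+ _).
by apply: eq_card => q; rewrite inE.
Qed.

(** * Mass of the squared coefficients, by size of support *)

Section Weights.
Variable R : realFieldType.

Definition fhat psi : R := (per psi)%:~R / (#|G| `!)%:R.

Lemma fhat0 : fhat [ffun=> 0] = 1.
Proof. by rewrite /fhat per0 rmorph_nat divff // pnatr_eq0 -lt0n fact_gt0. Qed.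

Lemma fhat_perm (s : {perm G}) psi : fhat [ffun i => psi (s i)] = fhat psi.
Proof. by rewrite /fhat per_perm. Qed.

Lemma sqr_fhat_shift c psi : fhat [ffun i => psi i + c] ^+ 2 = fhat psi ^+ 2.
Proof. by rewrite /fhat !exprMn -!rmorphXn sqr_per_shift. Qed.

Lemma sum_fhat_bump psi a : a != 0 -> \sum_i fhat (bump psi i a) = 0.
Proof.
by move=> a0; rewrite /fhat -mulr_suml -rmorph_sum (sum_per_bump _ a0) mul0r.
Qed.

(** N^j times the collision probability of j samples drawn without replacement, where N is the order
    of the group. *)
Definition energy j : R := #|G|%:R ^+ j * ((#|G| - j)`!)%:R / (#|G| `!)%:R.

Lemma sum_sqr_fhat Q : \sum_(psi | supp psi \subset Q) fhat psi ^+ 2 = energy #|Q|.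
Proof.
have f0 : (#|G| `!)%:R != 0 :> R by rewrite pnatr_eq0 -lt0n fact_gt0.
rewrite /fhat (eq_bigr (fun psi => (per psi ^+ 2)%:~R / (#|G| `!)%:R ^+ 2)) => [|psi _].
  rewrite -mulr_suml -rmorph_sum sum_sqr_per rmorphM rmorphXn /= !rmorph_nat.
  by rewrite natrM /energy; field.
by rewrite exprMn exprVn rmorphXn.
Qed.

(** The [k]-th forward difference of [f] at [j]; it performs the inclusion-exclusion from supports
    contained in a set to supports equal to it. *)
Fixpoint fdiff (f : nat -> R) k j : R :=
  if k is k'.+1 then fdiff f k' j.+1 - fdiff f k' j else f j.

(** Induction on [A]: the characters that must contain a point [a] are those allowed to contain it
    minus those forbidden to, which is one difference step. *)
Lemma sum_sqr_fhat_between A B : [disjoint A & B] ->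
  \sum_(psi | (A \subset supp psi) && (supp psi \subset A :|: B)) fhat psi ^+ 2 =
  fdiff energy #|A| #|B|.
Proof.
move: {2}#|A| (erefl #|A|) => k; elim: k A B => [|k IH] A B.
  move/eqP; rewrite cards_eq0 => /eqP-> _; rewrite cards0 /= -sum_sqr_fhat.
  by apply: eq_bigl => psi; rewrite sub0set set0U.
move=> cA; have [a aA] : exists a, a \in A by apply/card_gt0P; rewrite cA.
rewrite -(setD1K aA) cardsU1 !inE eqxx /=; move: cA; rewrite (cardsD1 a) aA => -[].
set A' := A :\ a => cA' dAB.
have aB : a \notin B by have := disjointFr dAB; rewrite setD1K // => ->.
have aA' : a \notin A' by rewrite !inE eqxx.
have dA'B : [disjoint A' & B].
  by apply: disjointWl dAB; rewrite setD1K // subsetDl.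
have dA'aB : [disjoint A' & a |: B].
  by rewrite disjoint_sym disjoints_subset subUset sub1set inE aA' -disjoints_subset disjoint_sym.
rewrite -(IH _ _ cA' dA'B) /=.
have := IH _ _ cA' dA'aB; rewrite cardsU1 aB add1n => <-.
apply/eqP; rewrite eq_sym subr_eq eq_sym; apply/eqP.
rewrite [RHS](bigID (fun psi => a \in supp psi)) /=; congr (_ + _); apply: eq_bigl => psi.
  by rewrite subUset sub1set -setUA setUCA -andbA andbC.
case: (boolP (a \in supp psi)) => ap; rewrite /= ?andbT ?andbF.
  apply/negbTE; rewrite negb_and; apply/orP; right; apply/subsetPn; exists a => //.
  by rewrite inE negb_or aA'.
congr (_ && _); rewrite setUCA; apply/idP/idP => [h|/subsetP h].
  by apply: subset_trans h (subsetUr _ _).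
apply/subsetP => x xp; have := h x xp; rewrite !inE.
by case/orP => // /eqP xa; move: ap; rewrite -xa xp.
Qed.

Definition weight k := fdiff energy k 0.

Lemma sum_sqr_fhat_supp A : \sum_(psi | supp psi == A) fhat psi ^+ 2 = weight #|A|.
Proof.
rewrite /weight -[X in fdiff _ _ X](cards0 G) -sum_sqr_fhat_between.
  by apply: eq_bigl => psi; rewrite setU0 eqEsubset andbC.
by rewrite disjoints_subset setC0 subsetT.
Qed.

Lemma sum_sqr_fhat_level k :
  \sum_(psi | #|supp psi| == k) fhat psi ^+ 2 = 'C(#|G|, k)%:R * weight k.
Proof.
rewrite (partition_big supp (fun A => #|A| == k)) //=.
rewrite (eq_bigr (fun=> weight k)) => [|A /eqP kA].
  rewrite sumr_const -card_draws mulr_natl; congr (_ *+ _).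
  by apply: eq_card => A; rewrite inE.
rewrite -kA -sum_sqr_fhat_supp; apply: eq_bigl => psi.
by case: (supp psi =P A) => [->|]; rewrite ?eqxx ?andbF.
Qed.

Lemma card_supersets A : #|[set Q : {set G} | A \subset Q]| = (2 ^ (#|G| - #|A|))%N.
Proof.
have -> : (#|G| - #|A| = #|~: A|)%N by rewrite -(cardsC A) addKn.
rewrite -card_powerset -(card_imset _ (can_inj (@setCK G))); apply: eq_card => Q.
apply/imsetP/idP => [[B]|]; rewrite !inE; first by rewrite -setCS => h ->.
by move=> h; exists (~: Q); rewrite ?setCK // inE -setCS setCK.
Qed.

Lemma card_supersets_of_card A m : (m <= #|G|)%N ->
  #|[set Q : {set G} | (A \subset Q) && (#|Q| == m)]| = 'C(#|G| - #|A|, #|G| - m).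
Proof.
move=> mG; have -> : (#|G| - #|A| = #|~: A|)%N by rewrite -(cardsC A) addKn.
rewrite -cards_draws -(card_imset _ (can_inj (@setCK G))); apply: eq_card => Q.
have cC (B : {set G}) : (#|~: B| = #|G| - #|B|)%N by rewrite -(cardsC B) addKn.
apply/imsetP/idP => [[B]|]; rewrite !inE.
  by move=> /andP[h /eqP hm] ->; rewrite setCS h cC hm eqxx.
move=> /andP[h /eqP hm]; exists (~: Q); rewrite ?setCK // inE -setCS setCK h /=.
by rewrite cC hm subKn.
Qed.

(** Parseval is summed over all sets [Q]: a character with support of size k lies in 2^(N-k) of
    them, and there are C(N,j) sets of size j, each of energy N^j (N-j)! / N!. *)
Lemma sum_weight_pow2 :
  \sum_psi 2 ^+ (#|G| - #|supp psi|) * fhat psi ^+ 2 =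
  \sum_(j < #|G|.+1) #|G|%:R ^+ j / (j`!)%:R.
Proof.
transitivity (\sum_(Q : {set G}) \sum_(psi | supp psi \subset Q) fhat psi ^+ 2).
  rewrite (exchange_big_dep xpredT) //=; apply: eq_bigr => psi _.
  rewrite sumr_const -natrX -card_supersets mulr_natl; congr (_ *+ _).
  by apply: eq_card => Q; rewrite inE.
rewrite (eq_bigr _ (fun Q _ => sum_sqr_fhat Q)).
rewrite (partition_big (fun Q : {set G} => inord #|Q| : 'I_#|G|.+1) xpredT) //=.
apply: eq_bigr => j _.
have ec (Q : {set G}) : (inord #|Q| == j) = (#|Q| == j).
  by rewrite -val_eqE /= inordK // ltnS max_card.
rewrite (eq_bigl _ _ ec) (eq_bigr (fun=> energy j)) => [|Q /eqP-> //].
rewrite sumr_const; have -> : #|[pred Q : {set G} | #|Q| == j]| = 'C(#|G|, j).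
  by rewrite -card_draws; apply: eq_card => A; rewrite !inE.
have jG : (j <= #|G|)%N by rewrite -ltnS.
rewrite -[LHS]mulr_natl /energy.
have f0 n : (n`!)%:R != 0 :> R by rewrite pnatr_eq0 -lt0n fact_gt0.
have c0 : 'C(#|G|, j)%:R != 0 :> R by rewrite pnatr_eq0 -lt0n bin_gt0.
rewrite -(bin_fact jG) !natrM; field.
by rewrite !f0 c0.
Qed.

Lemma level_mass_le k : (k <= #|G|)%N ->
  2 ^+ (#|G| - k) * ('C(#|G|, k)%:R * weight k) <=
  \sum_(j < #|G|.+1) #|G|%:R ^+ j / (j`!)%:R.
Proof.
move=> kG; rewrite -sum_weight_pow2 -sum_sqr_fhat_level mulr_sumr.
rewrite [leRHS](bigID (fun psi => #|supp psi| == k)) /=.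
rewrite (eq_bigr (fun psi => 2 ^+ (#|G| - #|supp psi|) * fhat psi ^+ 2)) => [|psi /eqP-> //].
by rewrite lerDl sumr_ge0 // => psi _; rewrite mulr_ge0 ?sqr_ge0 // exprn_ge0.
Qed.

(** The ratio of consecutive energies gives N (e(j+1) - e(j)) = j e(j+1). Taking [k] further
    differences adds only one correction term, because the coefficient j is linear. *)
Lemma fdiff_energy_rec k j : (j + k < #|G|)%N ->
  #|G|%:R * fdiff energy k.+1 j =
  j%:R * fdiff energy k j.+1 + k%:R * fdiff energy k.-1 j.+2.
Proof.
elim: k j => [|k IH] j jk.
  rewrite mul0r addr0 /= /energy.
  have -> : (#|G| - j = (#|G| - j.+1).+1)%N by lia.
  have e : (#|G| - j.+1).+1%:R = #|G|%:R - j%:R :> R by rewrite -natrB; [congr _%:R; lia|lia].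
  by rewrite factS natrM e exprS; ring.
have -> : fdiff energy k.+2 j = fdiff energy k.+1 j.+1 - fdiff energy k.+1 j by [].
rewrite mulrBr (IH j.+1 ltac:(lia)) (IH j ltac:(lia)) -pred_Sn.
have -> : k%:R * fdiff energy k.-1 j.+3 = k%:R * fdiff energy k.-1 j.+2 + k%:R * fdiff energy k j.+2.
  by case: k {IH jk} => [|k]; rewrite ?mul0r ?addr0 // -mulrDr -pred_Sn /=; congr (_ * _); ring.
have -> : fdiff energy k.+1 j.+1 = fdiff energy k j.+2 - fdiff energy k j.+1 by [].
by rewrite -[k.+1%:R]natr1 -[j.+1%:R]natr1; ring.
Qed.

(** The preceding recursion at [j = 0], where the shift by two is expanded as the square of the
    identity plus the difference operator. *)
Lemma weight_rec k : (k.+1 < #|G|)%N ->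
  (#|G|%:R - k.+1%:R) * weight k.+2 = k.+1%:R * (2 * weight k.+1 + weight k).
Proof.
move=> kG; have := @fdiff_energy_rec k.+1 0%N ltac:(lia).
rewrite mul0r add0r -/(weight _) mulrBl => ->.
have -> : fdiff energy k 2 = weight k + 2 * weight k.+1 + weight k.+2 by rewrite /weight /=; ring.
ring.
Qed.

Lemma weight_0 : weight 0 = 1.
Proof.
by rewrite /weight /= /energy expr0 subn0 mul1r divff // pnatr_eq0 -lt0n fact_gt0.
Qed.

Lemma weight_1 : weight 1 = 0.
Proof.
have G0 : (0 < #|G|)%N by apply/card_gt0P; exists 0.
have := @fdiff_energy_rec 0%N 0%N G0; rewrite !mul0r addr0 => /eqP.
by rewrite mulf_eq0 pnatr_eq0 (gtn_eqF G0) => /eqP.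
Qed.

End Weights.
End Permanent.

(** * Bounding a coefficient by averaging over phases *)

Section Fibers.
Variable T : finType.
Implicit Types (phi psi : {ffun T -> T}).

Definition mult psi a := #|[set i | psi i == a]|.

Lemma sum_mult psi : (\sum_a mult psi a = #|T|)%N.
Proof.
rewrite -[RHS]sum1_card [RHS](partition_big psi xpredT) //=; apply: eq_bigr => a _.
by rewrite /mult -sum1dep_card.
Qed.

Lemma mult_le psi a : (mult psi a <= #|T|)%N.
Proof. exact: max_card. Qed.

Lemma prod_fiber (R : comPzSemiRingType) psi (f : T -> R) :
  \prod_i f (psi i) = \prod_a f a ^+ mult psi a.
Proof.
rewrite (partition_big psi xpredT) //=; apply: eq_bigr => a _.
rewrite (eq_bigr (fun=> f a)) => [|i /eqP-> //]; rewrite prodr_const; congr (_ ^+ _).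
by apply: eq_card => i; rewrite !inE.
Qed.

(** Equal multiplicities mean that the two lists of values are rearrangements of each other. *)
Lemma eq_mult_perm phi psi : mult phi =1 mult psi ->
  exists s : {perm T}, forall x, phi x = psi (s x).
Proof.
move=> e.
have cm (f : {ffun T -> T}) a : count_mem a (codom f) = mult f a.
  rewrite /codom /image_mem count_map /mult cardE -size_filter enumT; congr size.
  by rewrite /enum_mem; apply: eq_filter => i; rewrite !inE.
have : perm_eq (codom_tuple phi) (codom_tuple psi).
  by apply/allP => a _ /=; rewrite !cm e.
case/tuple_permP => p ep.
have inj : injective (fun x => enum_val (p (enum_rank x))).
  by move=> x y /enum_val_inj /perm_inj /enum_rank_inj.
exists (perm inj) => x; rewrite permE.
have tn (f : {ffun T -> T}) i : tnth (codom_tuple f) i = f (enum_val i).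
  by rewrite (tnth_nth (f (enum_val i))) /= /codom /image_mem (nth_map (enum_val i)) -?enum_val_nth // -cardE.
rewrite -tn -[in LHS](enum_rankK x) -tn.
have -> : codom_tuple phi = [tuple tnth (codom_tuple psi) (p i) | i < #|T|] by apply: val_inj.
by rewrite tnth_mktuple.
Qed.

(** A permutation preserving [psi] maps each fiber to itself and is determined by its restrictions
    to the fibers. *)
Lemma card_fiber_stabilizer psi :
  (#|[set p : {perm T} | [forall i, psi (p i) == psi i]]| <= \prod_a (mult psi a)`!)%N.
Proof.
pose fib a := [set i | psi i == a].
pose F a : pred {perm T} := perm_on (fib a).
have <- : #|family F| = (\prod_a (mult psi a)`!)%N.
  rewrite card_family foldrE big_image /=; apply: eq_bigr => a _.
  by rewrite -card_perm.
have N p a : p \in [set p : {perm T} | [forall i, psi (p i) == psi i]] -> p \in 'N(fib a | 'P)%g.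
  rewrite inE => /forallP h; apply/astabsP => x.
  by rewrite !inE /= /aperm (eqP (h x)).
pose g p : {ffun T -> {perm T}} := [ffun a => restr_perm (fib a) p].
rewrite -(card_in_imset (f := g)) => [|p q hp hq /ffunP e]; last first.
  apply/permP => i; have := e (psi i); rewrite !ffunE => /permP /(_ i).
  by rewrite !restr_permE ?N // inE.
apply: subset_leq_card; apply/subsetP => _ /imsetP[p hp ->].
by apply/familyP => a; rewrite ffunE; apply: restr_perm_on.
Qed.

End Fibers.

Lemma sum_prim_root_expr (F : fieldType) M (z : F) e : M.-primitive_root z ->
  \sum_(t < M) z ^+ (t * e) = if (M %| e)%N then M%:R else 0.
Proof.
move=> zp; rewrite (eq_bigr (fun t : 'I_M => (z ^+ e) ^+ t)) => [|t _]; last by rewrite mulnC exprM.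
rewrite (prim_order_dvd zp); case: eqP => [->|/eqP h].
  by rewrite (eq_bigr (fun=> 1)) ?sumr_const ?card_ord // => i _; rewrite expr1n.
have := subrX1 (z ^+ e) M; rewrite exprAC (prim_expr_order zp) expr1n subrr.
by move/esym/eqP; rewrite mulf_eq0 subr_eq0 (negbTE h) /= => /eqP.
Qed.

Section PhaseBound.
Variables (G : finZmodType) (chi : char_pairing G).
Implicit Types (phi psi : {ffun G -> G}).

(** Each rearrangement of [psi] is counted once here; the permanent counts it as many times as there
    are permutations preserving [psi]. *)
Let typesum psi : int :=
  \sum_(phi : {ffun G -> G} | [forall a, mult phi a == mult psi a]) \prod_x chi (phi x) x.

(* Averaging over the phases z ^ t a picks out of prod_x (sum_a r_a z^(t_a) chi_a(x)) the terms with
   the multiplicities of psi.  AM-GM over x is sharp enough because r_a^2 = mult psi a. *)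
Lemma sqr_typesum_le psi :
  typesum psi ^+ 2 * \prod_a (mult psi a)%:R ^+ mult psi a <= #|G|%:R ^+ #|G| :> int.
Proof.
(* The order |G| + 1 exceeds every difference of two multiplicities, so divisibility by it detects
   equality. The exponent [M - mult psi a] stands for the negative of the multiplicity. *)
have [z zp] := C_prim_root_exists (ltn0Sn #|G|).
set M := #|G|.+1 in zp *; set N := #|G|.
pose r a : algC := sqrtC (mult psi a)%:R.
pose l (t : {ffun G -> 'I_M}) x : algC := \sum_a r a * z ^+ t a * (chi a x)%:~R.
pose w (t : {ffun G -> 'I_M}) : algC := \prod_a z ^+ (t a * (M - mult psi a)).
have nz : `|z| = 1.
  apply/eqP; rewrite -(pexpr_eq1 (n := M)) // -normrX (prim_expr_order zp) normr1 //.
have sumE : \sum_t w t * \prod_x l t x =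
    M%:R ^+ N * (\prod_a r a ^+ mult psi a) * (typesum psi)%:~R.
  rewrite (eq_bigr (fun t : {ffun G -> 'I_M} => \sum_(phi : {ffun G -> G})
      (\prod_x (r (phi x) * (chi (phi x) x)%:~R)) * \prod_a z ^+ (t a * (mult phi a + (M - mult psi a))))) => [|t _]; last first.
    rewrite bigA_distr_bigA mulr_sumr; apply: eq_bigr => phi _.
    have e1 : \prod_a z ^+ (t a * (mult phi a + (M - mult psi a))) = (\prod_x z ^+ t (phi x)) * w t.
      rewrite (prod_fiber phi (fun a => z ^+ t a)) -big_split /=.
      by apply: eq_bigr => a _; rewrite -exprM -exprD mulnDr.
    have e2 : \prod_x (r (phi x) * z ^+ t (phi x) * (chi (phi x) x)%:~R) =
        \prod_x (r (phi x) * (chi (phi x) x)%:~R) * \prod_x z ^+ t (phi x).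
      by rewrite -big_split; apply: eq_bigr => x _; rewrite mulrAC.
    by rewrite e1 e2 mulrC mulrA.
  rewrite exchange_big /= rmorph_sum mulr_sumr [RHS]big_mkcond /=; apply: eq_bigr => phi _.
  rewrite -mulr_sumr -(bigA_distr_bigA (fun a (t : 'I_M) => z ^+ (t * (mult phi a + (M - mult psi a))))).
  rewrite [X in _ * X](eq_bigr (fun a => if mult phi a == mult psi a then M%:R else 0)) => [|a _]; last first.
    rewrite (sum_prim_root_expr _ zp); congr (if _ then _ else _).
    have h1 : (mult phi a <= N)%N := mult_le phi a.
    have h2 : (mult psi a <= N)%N := mult_le psi a.
    apply/idP/eqP => [/dvdnP[[|[|k]]]|->].
    - by rewrite /M -/N; lia.
    - by rewrite /M -/N; lia.
    - by rewrite /M -/N; nia.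
    - by rewrite subnKC ?dvdnn // /M; lia.
  case: forallP => [h|/forallP]; last first.
    rewrite negb_forall => /existsP[a ha].
    by rewrite [X in _ * X](bigD1 a) //= (negbTE ha) mul0r mulr0.
  rewrite [X in _ * X](eq_bigr (fun=> M%:R)) ?prodr_const => [|a _]; last by rewrite h.
  rewrite big_split /= prod_fiber rmorph_prod -mulrA [RHS]mulrC; congr (_ * _).
  by congr (_ * _); apply: eq_bigr => a _; rewrite (eqP (h a)).
(* Distinct characters are orthogonal, so only the diagonal remains: N times the sum of the
   multiplicities, whatever the phases. AM-GM then bounds the product of the squared moduli by
   N^N. *)
have normsum t : \sum_x `|l t x| ^+ 2 = N%:R ^+ 2.
  have e x : `|l t x| ^+ 2 = \sum_a \sum_b (r a * z ^+ t a) * (r b * z ^+ t b)^* * (chi (a + b) x)%:~R.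
    rewrite normCK /l rmorph_sum mulr_suml; apply: eq_bigr => a _.
    rewrite mulr_sumr; apply: eq_bigr => b _.
    by rewrite [X in _ * X]rmorphM rmorph_int chiDl intrM mulrACA.
  rewrite (eq_bigr _ (fun x _ => e x)) exchange_big /=.
  rewrite (eq_bigr (fun a => N%:R * (mult psi a)%:R)) => [|a _]; last first.
    rewrite exchange_big /= (bigD1 a) //= [X in _ + X]big1 ?addr0 => [|b ba].
      rewrite -mulr_sumr -rmorph_sum chi_suml (char_two chi) eqxx rmorph_nat mulrC -normCK.
      by rewrite normrM normrX nz expr1n mulr1 ger0_norm ?sqrtC_ge0 ?ler0n // sqrtCK.
    rewrite -mulr_sumr -rmorph_sum chi_suml.
    have -> : (a + b == 0) = false.
      by rewrite -[X in _ == X](char_two chi a) (inj_eq (addrI a)) (negbTE ba).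
    by rewrite mulr0.
  by rewrite -mulr_sumr -natr_sum sum_mult expr2.
have N0 : (0 < N)%N by apply/card_gt0P; exists 0.
have AGM t : \prod_x `|l t x| <= sqrtC (N%:R ^+ N).
  have h0 : 0 <= \prod_x `|l t x| by apply: prodr_ge0 => x _.
  rewrite -(sqrCK h0) ler_sqrtC ?nnegrE ?exprn_ge0 ?ler0n // -prodrXl.
  have := leif_AGM (A := predT) (E := fun x => `|l t x| ^+ 2) (fun x _ => exprn_ge0 2 (normr_ge0 (l t x))).
  by case=> h _; move: h; rewrite normsum -/N expr2 mulfK ?pnatr_eq0 -?lt0n //.
have bnd : `|\sum_t w t * \prod_x l t x| <= M%:R ^+ N * sqrtC (N%:R ^+ N).
  apply: (le_trans (ler_norm_sum _ _ _)).
  apply: (@le_trans _ _ (\sum_(t : {ffun G -> 'I_M}) sqrtC (N%:R ^+ N))).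
    apply: ler_sum => t _; rewrite normrM normr_prod big1 ?mul1r ?normr_prod //.
    by move=> a _; rewrite normrX nz expr1n.
  by rewrite sumr_const card_ffun card_ord -natrX -[in leRHS]natrX mulr_natl.
have r0 a : 0 <= r a by rewrite sqrtC_ge0 ler0n.
have MN : 0 < (M%:R : algC) ^+ N by rewrite exprn_gt0 // ltr0n.
have P0 : 0 <= \prod_a r a ^+ mult psi a by apply: prodr_ge0 => a _; apply: exprn_ge0.
move: bnd; rewrite sumE -mulrA normrM (ger0_norm (ltW MN)) (ler_pM2l MN).
rewrite normrM (ger0_norm P0) => bnd.
have h1 : 0 <= (\prod_a r a ^+ mult psi a) * `|(typesum psi)%:~R| by rewrite mulr_ge0.
have h2 : 0 <= sqrtC (N%:R ^+ N) :> algC by rewrite sqrtC_ge0 exprn_ge0 ?ler0n.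
have := lerXn2r 2 h1 h2 bnd; rewrite sqrtCK exprMn -normrX -rmorphXn /=.
rewrite ger0_norm ?ler0z ?sqr_ge0 // -prodrXl.
rewrite (eq_bigr (fun a => ((mult psi a)%:R ^+ mult psi a)%:~R)) => [|a _]; last first.
  by rewrite exprAC sqrtCK rmorphXn /= rmorph_nat.
rewrite -rmorph_prod /= mulrC -rmorphM -(rmorph_nat (intmul 1)) -rmorphXn /= ler_int.
by [].
Qed.

(** The permanent is the order of the stabilizer of [psi] times [typesum psi]; the two factors are
    bounded separately. *)
Lemma sqr_per_le psi :
  per chi psi ^+ 2 * \prod_a (mult psi a)%:R ^+ mult psi a <=
  #|G|%:R ^+ #|G| * \prod_a (mult psi a)`!%:R ^+ 2.
Proof.
pose k := #|[set p : {perm G} | [forall i, psi (p i) == psi i]]|.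
have e : per chi psi = k%:R * typesum psi.
  rewrite /per (reindex_inj invg_inj) /=.
  rewrite (partition_big (fun p : {perm G} => [ffun x => psi (p x)])
     (fun phi => [forall a, mult phi a == mult psi a])) /= => [|p _]; last first.
    apply/forallP => a; rewrite /mult -(card_imset _ (@perm_inj _ p)); apply/eqP; apply: eq_card => x.
    apply/imsetP/idP => [[y]|]; rewrite !inE ?ffunE; first by move=> h ->.
    by move=> h; exists (p^-1 x)%g; rewrite ?inE ?ffunE permKV.
  rewrite mulr_sumr; apply: eq_bigr => phi /forallP h.
  have [|s hs] := @eq_mult_perm _ phi psi; first by move=> a; apply/eqP.
  rewrite (eq_bigr (fun _ : {perm G} => \prod_x chi (phi x) x)) => [|p /eqP<-]; last first.
    rewrite (reindex_inj (@perm_inj _ p)) /=; apply: eq_bigr => x _.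
    by rewrite permK ffunE.
  rewrite sumr_const mulr_natl /k; congr (_ *+ _).
  rewrite -[RHS](card_imset _ (mulgI s)); apply: eq_card => p.
  apply/idP/imsetP => [|[q]].
    rewrite -[_ \in _]/([ffun x => psi (p x)] == phi) => /eqP ep; exists (s^-1 * p)%g; last by rewrite mulKVg.
    rewrite inE; apply/forallP => i; rewrite permM.
    by move/ffunP: ep => /(_ (s^-1 i)%g); rewrite ffunE hs permKV => ->.
  rewrite inE => /forallP hq ->; rewrite -[_ \in _]/([ffun x => psi ((s * q)%g x)] == phi).
  apply/eqP/ffunP => x.
  by rewrite ffunE permM (eqP (hq _)) hs.
have k2 : k%:R ^+ 2 <= \prod_a (mult psi a)`!%:R ^+ 2 :> int.
  rewrite prodrXl -natr_prod; apply: lerXn2r; rewrite ?nnegrE ?ler0n //.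
  by rewrite ler_nat card_fiber_stabilizer.
rewrite e exprMn -mulrA [leRHS]mulrC; apply: ler_pM => //; try exact: sqr_ge0.
  by rewrite mulr_ge0 ?sqr_ge0 // prodr_ge0 // => a _; rewrite exprn_ge0.
exact: sqr_typesum_le.
Qed.

Lemma sqr_fhat_le_ufact (R : realFieldType) psi :
  fhat chi R psi ^+ 2 <= (\prod_a ufact R (mult psi a)) / ufact R #|G|.
Proof.
have f0 n : 0 < (n`!)%:R :> R by rewrite ltr0n fact_gt0.
have nn0 n : 0 < n%:R ^+ n :> R by case: n => // n; rewrite exprn_gt0 // ltr0n.
have := sqr_per_le psi; rewrite -(ler_int R) rmorphM /= [in leRHS]rmorphM /= !rmorph_prod /=.
rewrite [(per chi psi ^+ 2)%:~R]rmorphXn [(_ ^+ #|G|)%:~R]rmorphXn /= rmorph_nat.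
have -> : \prod_a ((mult psi a)%:R ^+ mult psi a)%:~R = \prod_a (mult psi a)%:R ^+ mult psi a :> R.
  by apply: eq_bigr => a _; rewrite rmorphXn /= rmorph_nat.
have -> : \prod_a ((mult psi a)`!%:R ^+ 2)%:~R = \prod_a (mult psi a)`!%:R ^+ 2 :> R.
  by apply: eq_bigr => a _; rewrite rmorphXn /= rmorph_nat.
have P0 : 0 < \prod_a (mult psi a)%:R ^+ mult psi a :> R by apply: prodr_gt0.
rewrite -ler_pdivlMr // => h.
rewrite /ufact prodf_div /fhat expr_div_n invf_div.
rewrite ler_pdivrMr ?exprn_gt0 //; apply: (le_trans h).
rewrite le_eqVlt; apply/orP; left; apply/eqP; field.
by rewrite (gt_eqF P0) (gt_eqF (f0 _)).
Qed.

End PhaseBound.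

(** * The fourth moment of the Fourier transform *)

(** Cauchy-Schwarz against the constant 1, from the nonnegativity of the sum of (n x_i - s)^2. *)
Lemma sqr_sum_le (R : realFieldType) (I : finType) (A : {pred I}) (x : I -> R) :
  (\sum_(i in A) x i) ^+ 2 <= #|A|%:R * \sum_(i in A) x i ^+ 2.
Proof.
case: (posnP #|A|) => [A0|A0].
  by rewrite A0 mul0r big1 ?expr0n // => i; have := card0_eq A0 i; rewrite /in_mem /= => ->.
set s := \sum_(i in A) x i; set t := \sum_(i in A) x i ^+ 2; set n : R := #|A|%:R.
have n0 : 0 < n by rewrite ltr0n.
have : 0 <= \sum_(i in A) (n * x i - s) ^+ 2 by apply: sumr_ge0 => i _; apply: sqr_ge0.
rewrite (eq_bigr (fun i => n ^+ 2 * x i ^+ 2 + (- 2 * n * s) * x i + s ^+ 2)) => [|i _]; last by ring.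
rewrite !big_split /= sumr_const -!mulr_sumr -/s -/t -[s ^+ 2 *+ _]mulr_natl -/n.
have -> : n ^+ 2 * t + - 2 * n * s * s + n * s ^+ 2 = n * (n * t - s ^+ 2) by ring.
by rewrite pmulr_rge0 // subr_ge0.
Qed.

Section FourthMoment.
Variables (G : finZmodType) (chi : char_pairing G) (R : realFieldType).
Implicit Types psi : {ffun G -> G}.
Local Notation fhat := (fhat chi R).
Local Notation weight := (weight G R).

(* In sum_fhat_bump with one coordinate of psi moved to 0, the N-k+1 bumps outside the remaining
   support all give fhat psi, and the k-1 others have level k-1 or k-2. *)
Lemma sqr_fhat_bin_le psi : (2 * #|supp psi| <= #|G|)%N ->
  'C(#|G|, #|supp psi|)%:R * fhat psi ^+ 2 <= 1.
Proof.
elim/ltn_ind: {psi}#|supp psi| {-2}psi (erefl #|supp psi|) => k IH psi kE.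
rewrite kE => kG.
case: (posnP k) => [k0|kpos].
  have -> : psi = [ffun=> 0].
    apply/ffunP => i; rewrite ffunE; apply/eqP; apply: contraT => pi.
    by have := card0_eq (etrans kE k0) i; rewrite inE pi.
  by rewrite k0 bin0 fhat0 expr1n mulr1.
have [p pS] : exists p, p \in supp psi by apply/card_gt0P; rewrite kE.
pose a := psi p; have a0 : a != 0 by move: pS; rewrite inE.
(* In characteristic two, adding [psi p] at [p] resets that coordinate to 0. *)
pose psi' := bump psi p a; pose S := supp psi :\ p.
have cS : #|S| = k.-1 by rewrite -kE [in RHS](cardsD1 p) pS.
have p'E j : psi' j = if j == p then 0 else psi j.
  by rewrite ffunE; case: eqP => [->|_]; rewrite ?addr0 // (char_two chi).
have := sum_fhat_bump chi R psi' a0; rewrite (bigID (mem S)) /=.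
rewrite [X in _ + X](eq_bigr (fun=> fhat psi)) => [|i iS]; last first.
  rewrite -[RHS](fhat_perm chi R (tperm p i)); congr fhat; apply/ffunP => j; rewrite [LHS]ffunE [RHS]ffunE.
  have pi0 : psi' i = 0.
    rewrite p'E; case: eqP => // /eqP ip; apply/eqP; move: iS.
    by rewrite !inE ip /= negbK.
  case: (tpermP p i j) => [->|->|/eqP jp /eqP ji].
  - case: (eqVneq p i) => [<-|pi]; first by rewrite p'E eqxx add0r.
    by move: pi0; rewrite !p'E eqxx addr0 [i == p]eq_sym (negbTE pi).
  - by rewrite eqxx pi0 add0r.
  - by rewrite (negbTE ji) addr0 p'E (negbTE jp).
rewrite sumr_const.
have -> : #|[pred i | i \notin S]| = (#|G| - k.-1)%N.
  by rewrite -cS -[#|G|](cardC (mem S)) addKn.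
have [[j kj]|k1] : {j | k = j.+2} + {k = 1%N}.
  by move: kpos; case: (k) => [//|[|j]] _; [right|left; exists j].
  (* At level 1 the set [S] is empty, so all N terms equal [fhat psi] and it vanishes. *)
  2: { rewrite big_pred0 => [|i]; last by apply: (card0_eq (A := mem S)); rewrite cS k1.
       rewrite add0r k1 subn0 => /eqP; rewrite mulrn_eq0.
       have /gtn_eqF -> : (0 < #|G|)%N by apply/card_gt0P; exists 0.
       by move=> /eqP->; rewrite expr0n mulr0 ler01. }
have c0 : 0 < 'C(#|G|, j)%:R :> R by rewrite ltr0n bin_gt0; lia.
(* A bump inside the support either cancels the value there (level k-2) or changes it to another
   nonzero value (level k-1). Binomials increase below N/2, so the bound at level k-2 covers
   both. *)
have bnd i : i \in S -> fhat (bump psi' i a) ^+ 2 <= 'C(#|G|, j)%:R^-1.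
  move=> iS; have [ip iP] : i != p /\ psi i != 0 by move: iS; rewrite !inE => /andP[].
  have sE x : (bump psi' i a x != 0) = if x == i then psi i + a != 0 else (x \in S).
    rewrite ffunE p'E !inE; case: (eqVneq x i) => [->|xi]; first by rewrite (negbTE ip).
    by rewrite addr0; case: (eqVneq x p) => [|_]; rewrite ?eqxx.
  rewrite -[leRHS]mul1r ler_pdivlMr // mulrC.
  case: (eqVneq (psi i + a) 0) => sa.
    have e : #|supp (bump psi' i a)| = j.
      have -> : supp (bump psi' i a) = S :\ i.
        apply/setP => x; rewrite inE sE in_setD1.
        by case: (eqVneq x i) => [->|//]; rewrite sa eqxx.
      by move: cS; rewrite (cardsD1 i) iS kj => -[].
    by have := IH j ltac:(lia) _ e; rewrite e => /(_ ltac:(lia)).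
  have e : #|supp (bump psi' i a)| = j.+1.
    have -> : supp (bump psi' i a) = S; last by rewrite cS kj.
    by apply/setP => x; rewrite inE sE; case: (eqVneq x i) => [->|//]; rewrite sa iS.
  have := IH j.+1 ltac:(lia) _ e; rewrite e => /(_ ltac:(lia)).
  apply: le_trans; rewrite ler_wpM2r ?sqr_ge0 // ler_nat.
  rewrite -(leq_pmul2l (ltn0Sn j)) mul_bin_left leq_mul //; lia.
move=> /eqP; rewrite addr_eq0 => /eqP sumE.
have h1 : ((#|G| - j.+1)%:R * fhat psi) ^+ 2 <= j.+1%:R ^+ 2 / 'C(#|G|, j)%:R.
  rewrite mulr_natl -sqrrN; move: sumE; rewrite kj /= => <-.
  apply: (le_trans (sqr_sum_le (mem S) _)).
  rewrite cS kj /= expr2 -mulrA ler_wpM2l ?ler0n //.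
  apply: (@le_trans _ _ (\sum_(i in S) 'C(#|G|, j)%:R^-1)); first exact: ler_sum.
  by rewrite sumr_const cS kj /= mulr_natl.
have e2 : 'C(#|G|, j.+2)%:R * (j.+2%:R * j.+1%:R) = 'C(#|G|, j)%:R * ((#|G| - j)%:R * (#|G| - j.+1)%:R) :> R.
  rewrite -!natrM; congr _%:R.
  by rewrite mulnA [('C(_, _) * j.+2)%N]mulnC mul_bin_left -mulnA [('C(_, _) * j.+1)%N]mulnC mul_bin_left; lia.
rewrite kj; rewrite ler_pdivlMr // in h1; move: h1 e2 c0.
have -> : (#|G| - j)%:R = (#|G| - j.+1)%:R + 1 :> R by rewrite natr1; congr _%:R; lia.
have jN : j.+2%:R <= (#|G| - j.+1)%:R :> R by rewrite ler_nat; lia.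
have e3 : j.+2%:R = j.+1%:R + 1 :> R by rewrite natr1.
have j0 : 0 < j.+1%:R :> R by rewrite ltr0n.
move: jN j0; rewrite e3; set x : R := j.+1%:R; set n : R := (#|G| - j.+1)%:R.
set c : R := 'C(#|G|, j)%:R; set C : R := 'C(#|G|, j.+2)%:R; set m := fhat psi ^+ 2.
move=> jN j0 h1 e2 c0.
have n0 : 0 < n by lra.
rewrite exprMn -/m in h1.
(* With x = k - 1 and n = N - k + 1, what remains is (n + 1) x <= (x + 1) n, that is x <= n. *)
have p0 : 0 < (x + 1) * x * n by rewrite !mulr_gt0 //; lra.
rewrite -(ler_pM2l p0) mulr1.
have -> : (x + 1) * x * n * (C * m) = (n + 1) * (n ^+ 2 * m * c).
  have -> : (x + 1) * x * n * (C * m) = C * ((x + 1) * x) * (n * m) by ring.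
  by rewrite e2; ring.
apply: (@le_trans _ _ ((n + 1) * x ^+ 2)); first by rewrite ler_wpM2l //; lra.
have -> : (n + 1) * x ^+ 2 = x * ((n + 1) * x) by ring.
have -> : (x + 1) * x * n = x * ((x + 1) * n) by ring.
by rewrite ler_wpM2l //; lra.
Qed.

Definition zero_mode psi := [forall a, (mult psi a <= mult psi 0%R)%N].

Lemma mult_shift psi c a : mult [ffun i => psi i + c] a = mult psi (a + c).
Proof.
apply: eq_card => i; rewrite !inE ffunE -[RHS](inj_eq (addIr c)).
by rewrite -addrA (char_two chi) addr0.
Qed.

Lemma mult0_supp psi : mult psi 0 = (#|G| - #|supp psi|)%N.
Proof.
rewrite -(cardsC (supp psi)) addKn; apply: eq_card => i; by rewrite !inE negbK.
Qed.

(** Every [psi] has a most frequent value c, and adding the constant c moves it to 0. This keeps the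
    fourth power and turns [mult psi 0] into [mult psi c], whose sum over c is at most N. *)
Lemma sum_mult0_le :
  \sum_(psi | psi != [ffun=> 0]) (mult psi 0)%:R * fhat psi ^+ 4 <=
  #|G|%:R * \sum_(psi | (psi != [ffun=> 0]) && zero_mode psi) fhat psi ^+ 4.
Proof.
have mu4 psi : 0 <= fhat psi ^+ 4 by rewrite exprn_even_ge0.
(* Being nonconstant is invariant under constant shifts, unlike being nonzero; nonzero constants
   have no zero value and contribute nothing on the left. *)
pose nc psi := psi != [ffun=> psi 0].
have ncS c psi : nc [ffun i => psi i + c] = nc psi.
  rewrite /nc; congr (~~ _); apply/eqP/eqP => /ffunP h; apply/ffunP => i; have := h i; rewrite !ffunE.
    by apply: addIr.
  by move=> ->.
pose mode psi c := [forall a, (mult psi a <= mult psi c)%N].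
apply: (@le_trans _ _ (\sum_(psi | nc psi) (mult psi 0)%:R * fhat psi ^+ 4)).
  rewrite big_mkcond [leRHS]big_mkcond; apply: ler_sum => psi _.
  case: (boolP (nc psi)) => [_|]; first by case: ifP => // _; rewrite mulr_ge0 ?ler0n.
  rewrite negbK => /eqP e; case: ifP => // p0.
  have -> : mult psi 0 = 0%N; last by rewrite mul0r.
  apply/eqP; rewrite cards_eq0; apply/eqP/setP => i; rewrite !inE e ffunE.
  by apply: contraNF p0 => /eqP p0; rewrite e p0.
apply: (@le_trans _ _ (\sum_(psi | nc psi) \sum_(c | mode psi c) (mult psi 0)%:R * fhat psi ^+ 4)).
  apply: ler_sum => psi _; rewrite sumr_const -[leRHS]mulr_natl.
  have m0 : 0 <= (mult psi 0)%:R * fhat psi ^+ 4 by rewrite mulr_ge0 ?ler0n.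
  rewrite -[leLHS]mul1r ler_wpM2r // ler1n.
  apply/card_gt0P; exists [arg max_(c > 0) mult psi c]; case: arg_maxnP => // c _ h.
  by apply/forallP => a; apply: h.
rewrite (exchange_big_dep xpredT) //=.
rewrite (eq_bigr (fun c => \sum_(psi | nc psi && zero_mode psi) (mult psi c)%:R * fhat psi ^+ 4)) => [|c _].
  rewrite exchange_big /= mulr_sumr big_mkcond [leRHS]big_mkcond /=; apply: ler_sum => psi _.
  rewrite -mulr_suml -natr_sum sum_mult.
  case: ifP => [/andP[np ->]|_]; last by case: ifP => // _; rewrite mulr_ge0 ?ler0n.
  case: eqP => [e|//]; move: np; rewrite /nc e ffunE eqxx //.
have shiftI : injective (fun psi => [ffun i => psi i + c]).
  by move=> f g /ffunP h; apply/ffunP => i; have := h i; rewrite !ffunE => /addIr.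
rewrite (reindex_inj shiftI) /=; apply: eq_big => psi.
  rewrite ncS; congr (_ && _); apply/forallP/forallP => h a.
    by have := h (a + c); rewrite !mult_shift -addrA (char_two chi) addr0.
  by rewrite !mult_shift (char_two chi).
move=> _; rewrite mult_shift add0r; congr (_ * _).
by rewrite -[4%N]/(2 * 2)%N !exprM sqr_fhat_shift.
Qed.

(** * Levels up to half of the group order N = 4q *)

Variable q : nat.
Hypothesis q0 : (0 < q)%N.
Hypothesis cardG : #|G| = (4 * q)%N.
(* K stands for 500 ^+ 8; leaving it abstract prevents conversion from computing it. *)
Variable K : R.
Hypothesis K_ge : 20 <= K.
Hypothesis decay_le : forall q, (4 * q).+1%:R ^+ 8 * (15 / 16) ^+ q <= K.
Local Notation b := ((4 * q).+1%:R : R).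

(** The eighth power in [decay_le] covers the at most six factors of [b] here and the two moved from
    the denominator. *)
Lemma geometric_decay n (x : R) : (n <= 6)%N -> 0 <= x -> x <= 15 / 16 ->
  b ^+ n * x ^+ q <= K / b ^+ 2.
Proof.
move=> n6 x0 x1; have b1 : 1 <= b by rewrite ler1n.
rewrite ler_pdivlMr ?exprn_gt0 //.
apply: le_trans (decay_le q).
rewrite mulrAC -exprD; apply: ler_pM; rewrite ?exprn_ge0 //; try lra.
  by apply: ler_weXn2l => //; lia.
by apply: lerXn2r; rewrite ?nnegrE //; lra.
Qed.

Lemma level_mass_le4 k : (k <= 4 * q)%N ->
  'C(4 * q, k)%:R * weight k <= 60 ^+ q / 2 ^+ (4 * q - k).
Proof.
move=> kq; rewrite ler_pdivlMr ?exprn_gt0 // mulrC -cardG.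
apply: le_trans (level_mass_le chi R _) _; first by rewrite cardG.
by rewrite cardG sum_exp_truncated_le.
Qed.

(** The majorant [g] from the mass bound is log-convex: its numerator is geometric and the binomials
    are log-concave. It therefore suffices to look at k = q and k = 2q. *)
Lemma weight_le_mid k : (q <= k <= 2 * q)%N -> weight k <= K / b ^+ 2.
Proof.
move=> kq; pose g k : R := 60 ^+ q / 2 ^+ (4 * q - k) / 'C(4 * q, k)%:R.
have c0 i : (i <= 4 * q)%N -> 0 < 'C(4 * q, i)%:R :> R by move=> h; rewrite ltr0n bin_gt0.
have wg : weight k <= g k.
  by rewrite ler_pdivlMr ?c0 ?[_ * 'C(_, _)%:R]mulrC ?level_mass_le4 //; lia.
apply: (le_trans wg).
apply: (@logconvex_le_ends _ g _ q (2 * q)%N) kq.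
- by move=> j h; rewrite !divr_gt0 ?exprn_gt0 ?c0 //; lia.
- move=> j h1 h2; rewrite /g.
  have e1 : (4 * q - j = (4 * q - j.+2).+2)%N by lia.
  have e2 : (4 * q - j.+1 = (4 * q - j.+2).+1)%N by lia.
  rewrite e1 e2 !(exprS (2 : R)); set t : R := 2 ^+ _; set L : R := 60 ^+ q.
  have t0 : 0 < t by apply: exprn_gt0.
  have L0 : 0 < L by apply: exprn_gt0.
  have a0 := c0 j ltac:(lia); have a1 := c0 j.+1 ltac:(lia); have a2 := c0 j.+2 ltac:(lia).
  have r1 : j.+1%:R * 'C(4 * q, j.+1)%:R = (4 * q - j)%:R * 'C(4 * q, j)%:R :> R.
    by rewrite -!natrM mul_bin_left.
  have r2 : j.+2%:R * 'C(4 * q, j.+2)%:R = (4 * q - j.+1)%:R * 'C(4 * q, j.+1)%:R :> R.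
    by rewrite -!natrM mul_bin_left.
  move: a0 a1 a2 r1 r2; set A : R := 'C(_, j)%:R; set B : R := 'C(_, j.+1)%:R; set C : R := 'C(_, j.+2)%:R.
  move=> a0 a1 a2 r1 r2.
  have AC : A * C <= B ^+ 2.
    have y0 : 0 < j.+2%:R * (4 * q - j)%:R :> R by rewrite mulr_gt0 ?ltr0n //; lia.
    rewrite -(ler_pM2l y0).
    have -> : j.+2%:R * (4 * q - j)%:R * (A * C) = (j.+1%:R * (4 * q - j.+1)%:R) * B ^+ 2.
      have -> : j.+2%:R * (4 * q - j)%:R * (A * C) = ((4 * q - j)%:R * A) * (j.+2%:R * C) by ring.
      by rewrite -r1 r2; ring.
    by rewrite ler_wpM2r ?sqr_ge0 // -!natrM ler_nat leq_mul //; lia.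
  have -> : (L / (2 * t) / B) ^+ 2 = L ^+ 2 / (4 * t ^+ 2) * (B ^+ 2)^-1.
    by field; rewrite !lt0r_neq0.
  have -> : L / (2 * (2 * t)) / A * (L / t / C) = L ^+ 2 / (4 * t ^+ 2) * (A * C)^-1.
    by field; rewrite !lt0r_neq0.
  have B2 : 0 < B ^+ 2 by apply: exprn_gt0.
  have ACp : 0 < A * C by apply: mulr_gt0.
  rewrite ler_wpM2l ?lef_pV2 ?posrE //.
  by rewrite divr_ge0 ?sqr_ge0 // mulr_ge0 ?sqr_ge0.
(* At k = q the base is 60 / 2^3 divided by 9; at k = 2q, below, it is 60 / 2^2 divided by 16, which
   is the extreme ratio 15/16. *)
- apply: (@le_trans _ _ (b ^+ 1 * (60 / 72) ^+ q)); last by apply: geometric_decay => //; lra.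
  rewrite /g ler_pdivrMr ?c0 //; last lia.
  have h : 9 ^+ q <= 'C(4 * q, q)%:R * b by rewrite -natrX -natrM ler_nat bin_quarter_lower.
  have e : (4 * q - q = 3 * q)%N by lia.
  have z0 : 0 < (60 / 72) ^+ q :> R by apply: exprn_gt0; lra.
  have -> : 60 ^+ q / 2 ^+ (4 * q - q) = (60 / 72) ^+ q * 9 ^+ q :> R.
    by rewrite e exprM -exprVn -!exprMn; congr (_ ^+ q); lra.
  by rewrite expr1 [b * _]mulrC -mulrA ler_pM2l // mulrC.
- apply: (@le_trans _ _ (b ^+ 1 * (60 / 64) ^+ q)); last by apply: geometric_decay => //; lra.
  rewrite /g ler_pdivrMr ?c0 //; last lia.
  have h : 4 ^+ (2 * q) <= 'C(4 * q, 2 * q)%:R * b.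
    rewrite -natrX -natrM ler_nat; have := bin_central_lower (2 * q).
    by have -> : ((2 * q).*2 = 4 * q)%N by lia.
  have e : (4 * q - 2 * q = 2 * q)%N by lia.
  have z0 : 0 < (60 / 64) ^+ q :> R by apply: exprn_gt0; lra.
  have -> : 60 ^+ q / 2 ^+ (4 * q - 2 * q) = (60 / 64) ^+ q * 4 ^+ (2 * q) :> R.
    by rewrite e !exprM -exprVn -!exprMn; congr (_ ^+ q); lra.
  by rewrite expr1 [b * _]mulrC -mulrA ler_pM2l // mulrC.
Qed.

Let N : R := (4 * q)%:R.

Lemma weight_le_low k : (3 <= k <= q)%N -> weight k <= 20 / N ^+ 2.
Proof.
move=> /andP[k3 kq].
have N4 : 12 <= N by rewrite ler_nat; lia.
have rec i : (i.+1 < 4 * q)%N -> (N - i.+1%:R) * weight i.+2 = i.+1%:R * (2 * weight i.+1 + weight i).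
  by move=> h; have := @weight_rec G R i; rewrite cardG; apply.
have w2 : (N - 1) * weight 2 = 1.
  by have := rec 0%N ltac:(lia); rewrite weight_0 weight_1; lra.
have w3 : (N - 2) * weight 3 = 4 * weight 2.
  by have := rec 1%N ltac:(lia); rewrite weight_1; lra.
have w4 : (N - 3) * weight 4 = 3 * (2 * weight 3 + weight 2) by exact: (rec 2 ltac:(lia)).
have N0 : 0 < N by lra.
have e2 : weight 2 = (N - 1)^-1 by apply: (mulfI (x := N - 1)); rewrite ?w2 ?divff ?gt_eqF //; lra.
have h2 : weight 2 * N <= 12 / 11.
  by rewrite e2 mulrC ler_pdivrMr; lra.
have p2 : 0 <= weight 2 by rewrite e2 invr_ge0; lra.
have h3 : weight 3 * N ^+ 2 <= 6.
  have h : (N - 2) * (weight 3 * N ^+ 2) <= (N - 2) * 6.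
    rewrite mulrA w3.
    have -> : 4 * weight 2 * N ^+ 2 = 4 * (weight 2 * N) * N by ring.
    nra.
  by move: h; rewrite ler_pM2l //; lra.
rewrite ler_pdivlMr ?exprn_gt0 //.
(* The recursion reaches back two levels, so two consecutive bounds are carried. The constant 20
   reproduces itself because 60 x <= 20 (N - x) when 4 x <= N. *)
suff H : forall i, (i.+3 <= q)%N ->
   weight i.+3 * N ^+ 2 <= 20 /\ ((i.+4 <= q)%N -> weight i.+4 * N ^+ 2 <= 20).
  by have [] := H (k - 3)%N ltac:(lia); have -> : (k - 3).+3 = k by lia.
elim=> [|i IH] iq.
  split=> [|q4]; first by lra.
  have N16 : 16 <= N by rewrite ler_nat; lia.
  have h : (N - 3) * (weight 4 * N ^+ 2) <= (N - 3) * 20.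
    rewrite mulrA w4.
    have -> : 3 * (2 * weight 3 + weight 2) * N ^+ 2 =
      6 * (weight 3 * N ^+ 2) + 3 * (weight 2 * N) * N by ring.
    nra.
  by move: h; rewrite ler_pM2l //; lra.
have [a1 a2] := IH ltac:(lia); have {}a2 := a2 iq; split=> // i5.
have := rec i.+3 ltac:(lia).
have i0 : 0 < i.+4%:R :> R by rewrite ltr0n.
have iN : 4 * i.+4%:R <= N by rewrite -natrM ler_nat; lia.
move: i0 iN a1 a2; set x : R := i.+4%:R; set u := weight i.+3; set v := weight i.+4; set w := weight i.+4.+1.
move=> i0 iN a1 a2 e.
have h : (N - x) * (w * N ^+ 2) <= (N - x) * 20.
  rewrite mulrA e; have -> : x * (2 * v + u) * N ^+ 2 = x * (2 * (v * N ^+ 2) + u * N ^+ 2) by ring.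
  nra.
by move: h; rewrite ler_pM2l //; lra.
Qed.

(** Level 1 vanishes, level 2 gives at most 2/N, and each remaining one of the N/2 levels gives at
    most K/N^2. *)
Lemma sum_weight_le : \sum_(1 <= k < (2 * q).+1) weight k <= (3 + K) / N.
Proof.
have N4 : 4 <= N by rewrite ler_nat; lia.
have N0 : 0 < N by lra.
have K20 := K_ge.
have Kb : K / b ^+ 2 <= K / N ^+ 2.
  have Nb : N ^+ 2 <= b ^+ 2 by apply: lerXn2r; rewrite ?nnegrE ?ler0n // ler_nat.
  have b2 : 0 < b ^+ 2 by rewrite exprn_gt0 // ltr0n.
  have N2 : 0 < N ^+ 2 by rewrite exprn_gt0.
  by rewrite ler_wpM2l ?lef_pV2 ?posrE //; lra.
have w2 : (N - 1) * weight 2 = 1.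
  by have := @weight_rec G R 0; rewrite cardG weight_0 weight_1 => /(_ ltac:(lia)); lra.
have e2 : weight 2 = (N - 1)^-1 by apply: (mulfI (x := N - 1)); rewrite ?w2 ?divff ?gt_eqF //; lra.
have wk k : (1 <= k < (2 * q).+1)%N -> weight k <= (if k == 2%N then 2 / N else 0) + K / N ^+ 2.
  move=> kq; have KN : 0 <= K / N ^+ 2 by rewrite divr_ge0 ?exprn_ge0 //; lra.
  case: eqP => [->|k2].
    rewrite -[leLHS]addr0; apply: lerD => //.
    have N1 : 0 < N - 1 by lra.
    by rewrite e2 ler_pdivlMr // mulrC ler_pdivrMr //; lra.
  rewrite add0r; case: (ltnP k q) => h; last first.
    by apply: le_trans Kb; apply: weight_le_mid; lia.
  case: (leqP 3 k) => k3.
    apply: (@le_trans _ _ (20 / N ^+ 2)); first by apply: weight_le_low; lia.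
    by rewrite ler_wpM2r // invr_ge0 exprn_ge0 //; lra.
  have -> : k = 1%N by lia.
  by rewrite weight_1.
apply: (@le_trans _ _ (\sum_(1 <= k < (2 * q).+1) ((if k == 2%N then 2 / N else 0) + K / N ^+ 2))).
  by rewrite big_nat_cond [leRHS]big_nat_cond; apply: ler_sum => k /andP[h _]; apply: wk.
rewrite big_split /= big_const_nat iter_addr_0 subSS subn0 -big_mkcond /=.
have -> : \sum_(1 <= i < (2 * q).+1 | i == 2%N) 2 / N = 2 / N.
  by rewrite big_nat1_eq; case: ifP => // /negbT; lia.
have -> : K / N ^+ 2 *+ (2 * q) = K / N / 2.
  rewrite -mulr_natr; have -> : (2 * q)%:R = N / 2 :> R by rewrite /N !natrM; lra.
  have half x : 0 < x -> K / x ^+ 2 * (x / 2) = K / x / 2.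
    by move=> x0; field; rewrite gt_eqF.
  exact: half.
rewrite [leRHS]mulrDl; apply: lerD; first by rewrite ler_wpM2r ?invr_ge0; lra.
have : 0 <= K / N by rewrite divr_ge0 //; lra.
lra.
Qed.

(** * Levels above half of the group order *)

Local Notation u := (ufact R).

(** Four parts are merged in two rounds of [sqr_ufact_le]: two mergers gaining 4^q each, then one
    gaining 16^q. *)
Lemma ufact_quarters_le : u q ^+ 4 <= u (4 * q) * (b ^+ 6 / 256 ^+ q).
Proof.
have h1 := sqr_ufact_le R q; have h2 := sqr_ufact_le R q.*2.
have e4 : (q.*2.*2 = 4 * q)%N by lia.
rewrite e4 in h2; move: h1 h2 => h1 h2.
have u2 := ufact_gt0 R q.*2; have u4 := ufact_gt0 R (4 * q).
have qb : q.*2.+1%:R ^+ 4 <= b ^+ 4 by apply: lerXn2r; rewrite ?nnegrE ?ler0n // ler_nat; lia.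
have z0 : 0 < 4 ^+ q :> R by apply: exprn_gt0.
have -> : u q ^+ 4 = (u q ^+ 2) ^+ 2 by rewrite -exprM.
apply: (@le_trans _ _ ((u q.*2 * (q.*2.+1%:R ^+ 2 / 4 ^+ q)) ^+ 2)).
  by apply: lerXn2r; rewrite ?nnegrE ?sqr_ge0 // mulr_ge0 ?(ltW u2) // divr_ge0 ?sqr_ge0 // ltW.
rewrite exprMn; apply: (le_trans (ler_wpM2r (sqr_ge0 _) h2)).
rewrite -mulrA ler_wpM2l ?(ltW u4) //.
have -> : 4 ^+ q.*2 = (4 ^+ q) ^+ 2 :> R by rewrite -muln2 exprM.
have -> : 256 ^+ q = (4 ^+ q) ^+ 4 :> R by rewrite exprAC; congr (_ ^+ q); ring.
move: z0; set z := 4 ^+ q => z0.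
have -> : b ^+ 2 / z ^+ 2 * (q.*2.+1%:R ^+ 2 / z) ^+ 2 = b ^+ 2 / z ^+ 4 * q.*2.+1%:R ^+ 4.
  by field; rewrite gt_eqF.
have -> : b ^+ 6 / z ^+ 4 = b ^+ 2 / z ^+ 4 * b ^+ 4 by field; rewrite gt_eqF.
by rewrite ler_wpM2l // divr_ge0 ?sqr_ge0 // exprn_ge0 // ltW.
Qed.

(** The left side is log-convex in [j], so only j = q and j = 2q matter. The division by 2^j is the
    one in the mass bound at level 4q - j, and it is what brings the decay at j = 2q from 16^q to
    64^q. *)
Lemma ufact_two_modes_le j : (q <= j <= 2 * q)%N ->
  u j ^+ 2 * u (4 * q - 2 * j) / 2 ^+ j <= u (4 * q) * (b ^+ 4 / 64 ^+ q).
Proof.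
move=> jq; pose f i := u i ^+ 2 * u (4 * q - 2 * i) / 2 ^+ i.
have u2 := ufact_gt0 R q.*2; have u4 := ufact_gt0 R (4 * q).
have h2 : u q.*2 ^+ 2 <= u (4 * q) * (b ^+ 2 / 16 ^+ q).
  have := sqr_ufact_le R q.*2; have -> : (q.*2.*2 = 4 * q)%N by lia.
  by have -> : 4 ^+ q.*2 = 16 ^+ q :> R by rewrite -mul2n exprM; congr (_ ^+ q); ring.
have h1 : u q ^+ 2 <= u q.*2 * (b ^+ 2 / 4 ^+ q).
  apply: le_trans (sqr_ufact_le R q) _; rewrite ler_pM2l //.
  rewrite ler_wpM2r ?invr_ge0 ?exprn_ge0 //.
  by apply: lerXn2r; rewrite ?nnegrE ?ler0n // ler_nat; lia.
have b1 : 1 <= b by rewrite ler1n.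
have b24 : b ^+ 2 <= b ^+ 4 by apply: ler_weXn2l.
have p q' : 0 < (2 : R) ^+ q' by apply: exprn_gt0.
have e4 : 4 ^+ q = (2 ^+ q) ^+ 2 :> R by rewrite exprAC; congr (_ ^+ q); ring.
have e16 : 16 ^+ q = (2 ^+ q) ^+ 4 :> R by rewrite exprAC; congr (_ ^+ q); ring.
have e64 : 64 ^+ q = (2 ^+ q) ^+ 6 :> R by rewrite exprAC; congr (_ ^+ q); ring.
have z1 : 1 <= (2 : R) ^+ q by apply: exprn_ege1; lra.
have z0 := p q; rewrite e64; rewrite e16 in h2; rewrite e4 in h1.
apply: (@logconvex_le_ends _ f _ q (2 * q)%N) jq => [i iq|i i1 i2||].
- rewrite /f; apply: divr_gt0 (p i); apply: mulr_gt0; last exact: ufact_gt0.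
  by apply: exprn_gt0; apply: ufact_gt0.
- rewrite /f; have -> : (4 * q - 2 * i = (4 * q - 2 * i.+2).+4)%N by lia.
  have -> : (4 * q - 2 * i.+1 = (4 * q - 2 * i.+2).+2)%N by lia.
  set s := (4 * q - 2 * i.+2)%N; rewrite !(exprS (2 : R)).
  have hs := @ufact_spread R s s.+2 2 ltac:(lia); rewrite addn2 !addnS addn0 in hs.
  have hi := ufact_logconvex R i.
  have := p i; have := ufact_gt0 R i; have := ufact_gt0 R i.+1; have := ufact_gt0 R i.+2.
  have := ufact_gt0 R s; have := ufact_gt0 R s.+2; have := ufact_gt0 R s.+4.
  move: hs hi; set t : R := 2 ^+ i; set a := u i; set a1 := u i.+1; set a2 := u i.+2.
  set c := u s; set c2 := u s.+2; set c4 := u s.+4.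
  move=> hs hi c40 c20 c0 a20 a10 a0 t0.
  have -> : (a1 ^+ 2 * c2 / (2 * t)) ^+ 2 = (a1 ^+ 2) ^+ 2 * (c2 * c2) / (4 * t ^+ 2).
    by field; rewrite gt_eqF.
  have -> : a ^+ 2 * c4 / t * (a2 ^+ 2 * c / (2 * (2 * t))) = (a * a2) ^+ 2 * (c * c4) / (4 * t ^+ 2).
    by field; rewrite gt_eqF.
  have w0 : 0 <= (4 * t ^+ 2)^-1 by rewrite invr_ge0 mulr_ge0 ?sqr_ge0.
  rewrite ler_wpM2r //.
  have hi2 : (a1 ^+ 2) ^+ 2 <= (a * a2) ^+ 2.
    by apply: lerXn2r; rewrite ?nnegrE ?sqr_ge0 // mulr_ge0 // ltW.
  by apply: ler_pM hi2 hs; [apply: sqr_ge0 | apply/ltW/mulr_gt0].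
- rewrite /f; have -> : (4 * q - 2 * q = q.*2)%N by lia.
  rewrite ler_pdivrMr //.
  apply: (le_trans (ler_wpM2r (ltW u2) h1)); rewrite mulrAC -expr2.
  have w0 : 0 <= b ^+ 2 / (2 ^+ q) ^+ 2 by rewrite divr_ge0 ?sqr_ge0.
  apply: (le_trans (ler_wpM2r w0 h2)); rewrite -[leLHS]mulrA -[leRHS]mulrA ler_wpM2l ?(ltW u4) //.
  move: z0 z1; set z : R := 2 ^+ q => z0 z1.
  have -> : b ^+ 2 / z ^+ 4 * (b ^+ 2 / z ^+ 2) = b ^+ 4 / z ^+ 6 by field; rewrite gt_eqF.
  by rewrite -[leLHS]mulr1 ler_wpM2l // divr_ge0 ?exprn_ge0 // ltW.
- rewrite /f; have -> : (4 * q - 2 * (2 * q) = 0)%N by lia.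
  rewrite ufact0 mulr1 mul2n; have -> : 2 ^+ q.*2 = (2 ^+ q) ^+ 2 :> R by rewrite -muln2 exprM.
  rewrite ler_pdivrMr ?exprn_gt0 //; apply: (le_trans h2); rewrite -[leRHS]mulrA ler_wpM2l ?(ltW u4) //.
  move: z0 z1; set z : R := 2 ^+ q => z0 z1.
  have -> : b ^+ 4 / z ^+ 6 * z ^+ 2 = b ^+ 4 / z ^+ 4 by field; rewrite gt_eqF.
  by rewrite ler_wpM2r ?invr_ge0 ?exprn_ge0 // ltW.
Qed.

(** One factor of squared coefficients is bounded through multiplicities, the other summed by the
    mass bound. Since 0 is a mode, no multiplicity exceeds j = N - k. *)
Lemma high_level_le k : (2 * q < k <= 4 * q)%N ->
  \sum_(psi | zero_mode psi && (#|supp psi| == k)) fhat psi ^+ 4 <= K / b ^+ 2.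
Proof.
move=> kq; pose j := (4 * q - k)%N.
have u4 := ufact_gt0 R (4 * q).
have bound B : 0 <= B ->
  (forall psi, zero_mode psi -> #|supp psi| = k -> \prod_a u (mult psi a) <= B) ->
  \sum_(psi | zero_mode psi && (#|supp psi| == k)) fhat psi ^+ 4 <= B / u (4 * q) * (60 ^+ q / 2 ^+ j).
  move=> B0 h; have B1 : 0 <= B / u (4 * q) by rewrite divr_ge0 // ltW.
  apply: (@le_trans _ _ (B / u (4 * q) * \sum_(psi | #|supp psi| == k) fhat psi ^+ 2)); last first.
    by rewrite sum_sqr_fhat_level cardG ler_wpM2l // level_mass_le4 //; lia.
  rewrite mulr_sumr big_mkcond [leRHS]big_mkcond; apply: ler_sum => psi _.
  case: (eqVneq #|supp psi| k) => [e|_]; last by rewrite andbF.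
  rewrite andbT; case: ifP => z0; last by rewrite mulr_ge0 ?sqr_ge0.
  rewrite -[4%N]/(2 + 2)%N exprD ler_wpM2r ?sqr_ge0 //.
  apply: le_trans (sqr_fhat_le_ufact chi R psi) _.
  by rewrite cardG ler_wpM2r ?invr_ge0 ?(ltW u4) //; apply: h.
have ml psi a : zero_mode psi -> #|supp psi| = k -> (mult psi a <= j)%N.
  by move=> /forallP h e; have := h a; rewrite mult0_supp e cardG.
have p2 i : 0 < (2 : R) ^+ i by apply: exprn_gt0.
have p60 : 0 < (60 : R) ^+ q by apply: exprn_gt0.
(* For j at most N/4 the extremal profile is four parts of size q; otherwise it has two parts of
   size j and the rest. *)
case: (leqP j q) => jq.
  apply: (le_trans (bound (u q ^+ 4) _ _)); first by rewrite exprn_ge0 // ltW // ufact_gt0.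
    move=> psi z e; have := @prod_ufact_le R G (index_enum G) (mult psi) q q0.
    rewrite sum_mult cardG mulnK // modnMl ufact0 mulr1; apply.
    by apply/allP => a _; apply: leq_trans (ml psi a z e) jq.
  apply: (@le_trans _ _ (b ^+ 6 / 256 ^+ q * 60 ^+ q)).
    apply: ler_pM; rewrite ?divr_ge0 ?exprn_ge0 // ?(ltW u4) // ?(ltW (ufact_gt0 _ _)) //.
      by rewrite ler_pdivrMr // mulrC ufact_quarters_le.
    rewrite ler_pdivrMr // -[leLHS]mulr1 ler_wpM2l ?(ltW p60) // exprn_ege1 //; lra.
  apply: (@le_trans _ _ (b ^+ 6 * (60 / 256) ^+ q)); last by apply: geometric_decay => //; lra.
  by rewrite mulrAC -mulrA exprMn exprVn.
have jq2 : (j <= 2 * q)%N by rewrite /j; lia.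
have j0 : (0 < j)%N by lia.
apply: (le_trans (bound (u j ^+ 2 * u (4 * q - 2 * j)) _ _)).
- by rewrite mulr_ge0 ?sqr_ge0 // ltW // ufact_gt0.
- move=> psi z e; have := @prod_ufact_le R G (index_enum G) (mult psi) j j0.
  rewrite sum_mult cardG => h; apply: (le_trans (h _)); first by apply/allP => a _; apply: ml.
  have e1 : (4 * q = 2 * j + (4 * q - 2 * j))%N by lia.
  rewrite {1 2}e1 divnMDl // modnMDl exprD -mulrA ler_wpM2l ?sqr_ge0 //.
  (* If a third part of size j fits, it is merged with the remainder by superadditivity. *)
  case: (ltnP (4 * q - 2 * j) j) => h3; first by rewrite divn_small // modn_small // mul1r.
  have e2 : (4 * q - 2 * j = 1 * j + (4 * q - 3 * j))%N by lia.
  rewrite e2 divnMDl // modnMDl divn_small ?modn_small; [|lia..].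
  by rewrite expr1 mul1n; apply: ufact_superadd.
have := @ufact_two_modes_le j ltac:(lia).
set D := u j ^+ 2 * _ => h.
have -> : D / u (4 * q) * (60 ^+ q / 2 ^+ j) = (D / 2 ^+ j) / u (4 * q) * 60 ^+ q.
  by field; rewrite !gt_eqF.
apply: (@le_trans _ _ (b ^+ 4 / 64 ^+ q * 60 ^+ q)).
  by rewrite ler_wpM2r ?(ltW p60) // ler_pdivrMr // [leRHS]mulrC.
apply: (@le_trans _ _ (b ^+ 4 * (60 / 64) ^+ q)); last by apply: geometric_decay => //; lra.
by rewrite mulrAC -mulrA exprMn exprVn.
Qed.

(** Up to level 2q, [sqr_fhat_bin_le] cancels the binomial in the level mass and leaves [weight k].
    The 2q higher levels contribute at most K/b^2 each. *)
Lemma fourth_moment_le :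
  \sum_(psi | (psi != [ffun=> 0]) && zero_mode psi) fhat psi ^+ 4 <= (3 + 2 * K) / N.
Proof.
have mu4 psi : 0 <= fhat psi ^+ 4 by rewrite exprn_even_ge0.
have N4 : 4 <= N by rewrite ler_nat; lia.
have N0 : 0 < N by lra.
have lev psi : psi != [ffun=> 0] -> (0 < #|supp psi| <= 4 * q)%N.
  move=> h; rewrite -cardG max_card andbT card_gt0; apply: contra h => /eqP/setP h.
  by apply/eqP/ffunP => i; have := h i; rewrite !inE ffunE => /negbFE/eqP.
apply: (@le_trans _ _ (\sum_(1 <= k < (4 * q).+1)
   \sum_(psi | zero_mode psi && (#|supp psi| == k)) fhat psi ^+ 4)).
  rewrite (exchange_big_dep zero_mode) /=; last by move=> k psi _ /andP[].
  rewrite big_mkcond [leRHS]big_mkcond; apply: ler_sum => psi _.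
  case: (zero_mode psi); rewrite ?andbF // andbT.
  rewrite (eq_bigl (fun k => k == #|supp psi|)) => [|k]; last by rewrite eq_sym.
  by rewrite big_nat1_eq; case: ifP => [/lev h|_]; [rewrite ltnS h | case: ifP].
have le1 : (1 <= (2 * q).+1)%N by [].
have le2 : ((2 * q).+1 <= (4 * q).+1)%N by lia.
rewrite (big_cat_nat le1 le2) /=.
have -> : (3 + 2 * K) / N = (3 + K) / N + K / N by rewrite -mulrDl; congr (_ / _); ring.
apply: lerD.
  apply: le_trans sum_weight_le; rewrite big_nat_cond [leRHS]big_nat_cond.
  apply: ler_sum => k /andP[/andP[k1 k2] _].
  have c0 : 0 < 'C(#|G|, k)%:R :> R by rewrite ltr0n bin_gt0 cardG; lia.
  rewrite -(ler_pM2l c0) -(sum_sqr_fhat_level chi) mulr_sumr.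
  rewrite big_mkcond [leRHS]big_mkcond; apply: ler_sum => psi _.
  case: (eqVneq #|supp psi| k) => [e|_]; last by rewrite andbF.
  rewrite andbT; case: ifP => _; last exact: sqr_ge0.
  rewrite -[4%N]/(2 + 2)%N exprD mulrA -[leRHS]mul1r ler_wpM2r ?sqr_ge0 // -e.
  by apply: sqr_fhat_bin_le; rewrite e cardG; lia.
apply: (@le_trans _ _ (\sum_((2 * q).+1 <= k < (4 * q).+1) K / b ^+ 2)).
  rewrite big_nat_cond [leRHS]big_nat_cond; apply: ler_sum => k /andP[h _].
  by apply: high_level_le; lia.
rewrite big_const_nat iter_addr_0 -[_ *+ (_ - _)]mulr_natr ler_pdivlMr //.
have -> : K / b ^+ 2 * ((4 * q).+1 - (2 * q).+1)%:R * N = K * (((4 * q).+1 - (2 * q).+1)%:R * N / b ^+ 2).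
  by rewrite -!mulrA; congr (_ * _); rewrite mulrC -!mulrA.
have K0 : 0 <= K by move: K_ge; lra.
rewrite -[leRHS]mulr1 ler_wpM2l //.
rewrite ler_pdivrMr ?exprn_gt0 ?ltr0n // mul1r expr2; apply: ler_pM; rewrite ?ler0n ?ler_nat //; lia.
Qed.

End FourthMoment.

(** * Adaptive queries *)

Lemma run_ext (T : Type) (t : qtree T) (g h : T -> T) : g =1 h -> run t g = run t h.
Proof. by move=> gh; elim: t => [//|x k IH] /=; rewrite gh. Qed.

Lemma at_most_queriesS (T : Type) (t : qtree T) m : at_most_queries m t -> at_most_queries m.+1 t.
Proof. by elim: t m => [//|x k IH] [//|m] /= h y; apply: IH. Qed.

Section Marginals.
Variables (G : finType) (delta : {ffun G -> G} -> R).
Hypothesis delta_perm : forall (s : {perm G}) (f : {ffun G -> G}), delta [ffun i => f (s i)] = delta f.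
Implicit Types (f : {ffun G -> G}) (L xs ys zs : seq G).
Local Notation N := (#|G|%:R : R).

Lemma card_agree L f : uniq L -> #|[set g : {ffun G -> G} | map g L == map f L]| = (#|G| ^ (#|G| - size L))%N.
Proof.
move=> uL; pose S i : pred G := if i \in L then pred1 (f i) else predT.
have -> : #|[set g : {ffun G -> G} | map g L == map f L]| = #|family S|.
  apply: eq_card => g; rewrite inE; apply/eqP/familyP => [/eq_in_map h i|h].
    by rewrite /S; case: ifP => // iL; rewrite inE h.
  by apply/eq_in_map => i iL; have := h i; rewrite /S iL inE => /eqP.
rewrite card_family foldrE big_image /=.
rewrite (eq_bigr (fun i => if i \in L then 1 else #|G|)%N) => [|i _]; last first.
  by rewrite /S; case: ifP => _; rewrite ?card1.
rewrite (bigID (mem L)) /= big1 => [|i ->] //; rewrite mul1n.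
rewrite (eq_bigr (fun=> #|G|)) => [|i /negbTE -> //]; rewrite prod_nat_const; congr (_ ^ _)%N.
by rewrite -(card_uniqP uL) -[#|G|](cardC (mem L)) addKn; apply: eq_card => i; rewrite !inE.
Qed.

Definition marginal L f : R := \sum_(g : {ffun G -> G} | map g L == map f L) delta g.

Lemma marginal_perm (s : {perm G}) L f : marginal (map s L) f = marginal L [ffun i => f (s i)].
Proof.
rewrite /marginal [RHS](reindex_inj (h := fun g : {ffun G -> G} => [ffun i => g (s i)])) /=; last first.
  move=> g h /ffunP e; apply/ffunP => i; have := e (s^-1 i)%g; rewrite !ffunE permKV //.
apply: eq_big => [g|g _]; last by rewrite delta_perm.
rewrite -!map_comp; congr (_ == _); apply: eq_map => i /=; by rewrite ffunE.
Qed.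

Lemma sum_marginal_agree xs ys L : uniq L -> {subset xs <= L} ->
  \sum_(f : {ffun G -> G} | map f xs == ys) marginal L f =
  N ^+ (#|G| - size L) * \sum_(f : {ffun G -> G} | map f xs == ys) delta f.
Proof.
move=> uL sxL; rewrite /marginal (exchange_big_dep (fun g : {ffun G -> G} => map g xs == ys)) /=; last first.
  move=> f g /eqP <- /eqP /eq_in_map e; apply/eqP/eq_in_map => i /sxL iL; exact: e.
rewrite mulr_sumr; apply: eq_bigr => g gx; rewrite sumr_const -natrX -(card_agree g uL) mulr_natl.
congr (_ *+ _); apply: eq_card => f; rewrite inE.
apply/andP/eqP => [[_ /eqP->] //|e]; rewrite e eqxx; split=> //.
by rewrite -(eqP gx); apply/eqP/eq_in_map => i /sxL iL; move/eq_in_map: e; apply.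
Qed.

(* The tree may be assumed to query the points of zs in order: a fresh query x is swapped with the
   next point of zs, and the law is invariant under this swap. *)
Lemma tree_marginal_le (t : qtree G) xs ys zs :
  at_most_queries (size zs) t -> uniq (xs ++ zs) -> size ys = size xs ->
  N ^+ (#|G| - size (xs ++ zs)) * `|\sum_(f : {ffun G -> G} | map f xs == ys) delta f * (run t f)%:R| <=
  \sum_(f : {ffun G -> G} | map f xs == ys) `|marginal (xs ++ zs) f|.
Proof.
elim: t xs ys zs => [b|x k IH] xs ys zs.
  move=> _ u _; case: b => /=; last first.
    by rewrite big1 ?normr0 ?mulr0 ?sumr_ge0 // => f _; rewrite mulr0.
  have N0 : 0 <= N ^+ (#|G| - size (xs ++ zs)) by rewrite exprn_ge0 ?ler0n.
  rewrite -{1}(ger0_norm N0) -normrM (eq_bigr delta) => [|f _]; last by rewrite mulr1.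
  rewrite -sum_marginal_agree // => [|i ix]; last by rewrite mem_cat ix.
  exact: ler_norm_sum.
(* The answer to a repeated query is already recorded in [ys], so the tree continues without
   consuming a point of [zs]. *)
move=> q u sz; case: (boolP (x \in xs)) => xxs.
  pose y := nth x ys (index x xs).
  rewrite (eq_bigr (fun f => delta f * (run (k y) f)%:R)) => [|f /eqP e]; last first.
    by rewrite /= /y -e (nth_map x) ?index_mem // nth_index.
  apply: IH => //; case: (zs) q => [//|z zs'] /= q; exact: at_most_queriesS.
case: zs q u => [//|z zs] /= q u.
have zxs : z \notin xs by move: u; rewrite cat_uniq /= negb_or => /and3P[_ /andP[]].
pose s := tperm x z; pose zs' := map s zs.
have sxs : map s xs = xs.
  apply/map_id_in => i ix; apply: tpermD; first by apply: contraNneq xxs => ->.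
  by apply: contraNneq zxs => ->.
have eL : rcons xs x ++ zs' = map s (xs ++ z :: zs) by rewrite map_cat /= sxs tpermR cat_rcons.
have uL : uniq (rcons xs x ++ zs') by rewrite eL map_inj_uniq //; apply: perm_inj.
have sL : size (xs ++ z :: zs) = size (rcons xs x ++ zs') by rewrite eL size_map.
have ev f y : (map f (rcons xs x) == rcons ys y) = (map f xs == ys) && (f x == y).
  by rewrite map_rcons eqseq_rcons.
have splitE (h : {ffun G -> G} -> R) : \sum_(f : {ffun G -> G} | map f xs == ys) h f =
    \sum_y \sum_(f : {ffun G -> G} | map f (rcons xs x) == rcons ys y) h f.
  rewrite (partition_big (fun f => f x) xpredT) //=; apply: eq_bigr => y _.
  by apply: eq_bigl => f; rewrite ev.
rewrite sL (splitE (fun f => delta f * _)).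
have -> : \sum_(f : {ffun G -> G} | map f xs == ys) `|marginal (xs ++ z :: zs) f| =
    \sum_(f : {ffun G -> G} | map f xs == ys) `|marginal (rcons xs x ++ zs') f|.
  rewrite (reindex_inj (h := fun g : {ffun G -> G} => [ffun i => g (s i)])) /=; last first.
    by move=> g h /ffunP e; apply/ffunP => i; have := e (s^-1 i)%g; rewrite !ffunE permKV.
  apply: eq_big => [g|g _]; last by rewrite eL marginal_perm.
  congr (_ == _); rewrite -[in RHS]sxs -map_comp; apply: eq_map => i; by rewrite ffunE.
rewrite splitE.
apply: (@le_trans _ _ (\sum_y N ^+ (#|G| - size (rcons xs x ++ zs')) *
   `|\sum_(f : {ffun G -> G} | map f (rcons xs x) == rcons ys y) delta f * (run (k y) f)%:R|)).
  rewrite -mulr_sumr ler_wpM2l ?exprn_ge0 ?ler0n //.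
  apply: (le_trans (ler_norm_sum _ _ _)); apply: ler_sum => y _.
  rewrite le_eqVlt; apply/orP; left; apply/eqP; congr `|_|; apply: eq_bigr => f.
  by rewrite ev => /andP[_ /eqP->].
apply: ler_sum => y _; apply: IH => //; last by rewrite !size_rcons sz.
by rewrite size_map; apply: q.
Qed.

(** [tree_marginal_le] from the empty transcript, then Cauchy-Schwarz over all functions. Expanding
    the squared marginals yields the pairs that agree on [L]. *)
Lemma sqr_tree_le (t : qtree G) L : at_most_queries (size L) t -> uniq L ->
  (\sum_(f : {ffun G -> G}) delta f * (run t f)%:R) ^+ 2 <=
  N ^+ size L * \sum_(f : {ffun G -> G}) \sum_(g : {ffun G -> G} | map g L == map f L) delta f * delta g.
Proof.
move=> q u; have := @tree_marginal_le t [::] [::] L q u erefl; rewrite /= => h.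
have mL : (size L <= #|G|)%N by rewrite -(card_uniqP u) max_card.
have h2 : (N ^+ (#|G| - size L) * `|\sum_(f : {ffun G -> G}) delta f * (run t f)%:R|) ^+ 2 <=
   N ^+ #|G| * \sum_(f : {ffun G -> G}) marginal L f ^+ 2.
  apply: (@le_trans _ _ ((\sum_(f : {ffun G -> G}) `|marginal L f|) ^+ 2)).
    by apply: lerXn2r; rewrite ?nnegrE ?mulr_ge0 ?exprn_ge0 ?ler0n ?sumr_ge0.
  apply: (le_trans (sqr_sum_le (mem {: {ffun G -> G}}) _)).
  rewrite card_ffun natrX ler_wpM2l ?exprn_ge0 ?ler0n //.
  by apply: ler_sum => f _; rewrite real_normK ?num_real.
have e : \sum_(f : {ffun G -> G}) marginal L f ^+ 2 =
    N ^+ (#|G| - size L) *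
    \sum_(f : {ffun G -> G}) \sum_(g : {ffun G -> G} | map g L == map f L) delta f * delta g.
  rewrite (eq_bigr (fun f => \sum_(g : {ffun G -> G} | map g L == map f L) delta g * marginal L g)) => [|f _].
    rewrite (exchange_big_dep xpredT) //= mulr_sumr; apply: eq_bigr => g _.
    rewrite sumr_const -mulr_sumr -natrX -(card_agree g u) -mulrnAl mulr_natl mulrnAl.
    by congr (_ *+ _); apply: eq_card => f; rewrite inE eq_sym.
  rewrite expr2 {1}/marginal mulr_suml; apply: eq_bigr => g /eqP e; congr (_ * _).
  by rewrite /marginal e.
move: h2; rewrite e exprMn real_normK ?num_real //.
case: (posnP #|G|) => [G0'|Gp].
  have L0 : size L = 0%N by move: mL; rewrite G0'; case: (size L).
  by rewrite G0' L0 sub0n !expr0 expr1n !mul1r.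
have NL : 0 < N ^+ (#|G| - size L) by rewrite exprn_gt0 // ltr0n.
have -> : N ^+ #|G| = N ^+ (#|G| - size L) * N ^+ size L by rewrite -exprD subnK.
have -> (a b c : R) : a * b * (a * c) = a ^+ 2 * (b * c) by ring.
by rewrite ler_pM2l // exprn_gt0.
Qed.

End Marginals.

Lemma avgE (T : finType) (f : T -> R) : avg f = (\sum_t f t) / #|T|%:R.
Proof. by rewrite /avg RdivE. Qed.

(** * Fourier analysis of the sum of two random permutations *)

Section SumOfPermutations.
Variables (G : finZmodType) (chi : char_pairing G).
Implicit Types (f g psi : {ffun G -> G}) (Q : {set G}).
Local Notation N := (#|G|%:R : R).
Local Notation fhat := (fhat chi R).
Local Notation F := ((#|G| `!)%:R : R).

Definition xor_perm (p r : {perm G}) : {ffun G -> G} := [ffun x => p x + r x].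

(** The law of p + r minus the uniform law on functions, as a signed measure; its integral against a
    test is the signed advantage. *)
Definition bias f :=
  (\sum_(pr : {perm G} * {perm G}) (xor_perm pr.1 pr.2 == f)%:R) / F ^+ 2 - (N ^+ #|G|)^-1.

Lemma bias_perm (s : {perm G}) f : bias [ffun i => f (s i)] = bias f.
Proof.
rewrite /bias; congr (_ / _ - _).
rewrite (reindex_inj (h := fun pr : {perm G} * {perm G} => (s * pr.1, s * pr.2)%g)) /=; last first.
  by move=> [a b] [c e] /= [/mulgI-> /mulgI->].
apply: eq_bigr => pr _; congr _%:R; congr nat_of_bool; apply/eqP/eqP => /ffunP h; apply/ffunP => i.
  by have := h (s^-1 i)%g; rewrite !ffunE !permM permKV.
by rewrite !ffunE !permM -h ffunE.
Qed.

Lemma sum_bias (h : {ffun G -> G} -> R) :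
  \sum_(f : {ffun G -> G}) bias f * h f = avg (fun pr : {perm G} * {perm G} => h (xor_perm pr.1 pr.2)) - avg h.
Proof.
rewrite /bias (eq_bigr (fun f => (\sum_(pr : {perm G} * {perm G}) (xor_perm pr.1 pr.2 == f)%:R * h f) / F ^+ 2
   - h f / (N ^+ #|G|))) => [|f _]; last by rewrite mulrBl mulrAC mulr_suml [X in _ - X]mulrC.
rewrite big_split /= -mulr_suml sumrN -mulr_suml exchange_big /=; congr (_ - _).
  rewrite avgE card_prod (card_perm_type G) natrM expr2; congr (_ / _); apply: eq_bigr => pr _.
  rewrite (bigD1 (xor_perm pr.1 pr.2)) //= eqxx mul1r big1 ?addr0 // => f.
  by rewrite eq_sym => /negbTE->; rewrite mul0r.
by rewrite avgE card_ffun natrX.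
Qed.

Definition wave psi f : R := \prod_i (chi (psi i) (f i))%:~R.

(** The law of p + r is a convolution, so its transform is the square of [fhat]. The uniform law has
    only the trivial coefficient, which cancels. *)
Lemma bias_hat psi : \sum_(f : {ffun G -> G}) bias f * wave psi f = if psi == [ffun=> 0] then 0 else fhat psi ^+ 2.
Proof.
rewrite sum_bias; have -> : avg (fun pr : {perm G} * {perm G} => wave psi (xor_perm pr.1 pr.2)) = fhat psi ^+ 2.
  rewrite avgE card_prod (card_perm_type G) natrM /fhat expr_div_n expr2 [in RHS]expr2; congr (_ / _).
  rewrite -(pair_bigA _ (fun p r : {perm G} => wave psi (xor_perm p r))) /=.
  rewrite /per rmorph_sum mulr_suml; apply: eq_bigr => p _.
  rewrite mulr_sumr; apply: eq_bigr => r _; rewrite !rmorph_prod -big_split /=.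
  by apply: eq_bigr => i _; rewrite ffunE chiDr rmorphM.
have -> : avg (wave psi) = if psi == [ffun=> 0] then 1 else 0.
  rewrite avgE card_ffun natrX /wave -(bigA_distr_bigA (fun i a => (chi (psi i) a)%:~R)) /=.
  rewrite (eq_bigr (fun i => if psi i == 0 then N else 0)) => [|i _]; last first.
    by rewrite -rmorph_sum chi_suml; case: ifP => _; rewrite ?rmorph_nat ?rmorph0.
  case: eqP => [->|/eqP psi0].
    rewrite (eq_bigr (fun=> N)) => [|i _]; last by rewrite ffunE eqxx.
    have -> : \prod_(i : G) N = N ^+ #|G| by rewrite prodr_const; congr (_ ^+ _); apply: eq_card.
    rewrite divff // expf_neq0 // pnatr_eq0 -lt0n.
    by apply/card_gt0P; exists 0.
  have [i psii] : exists i, psi i != 0.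
    apply/existsP; apply: contraNT psi0; rewrite negb_exists => /forallP h.
    by apply/eqP/ffunP => i; rewrite ffunE; apply/eqP; rewrite -[_ == _]negbK.
  by rewrite (bigD1 i) //= (negbTE psii) !mul0r.
case: eqP => [->|_]; last by rewrite subr0.
by rewrite fhat0 expr1n subrr.
Qed.

(** Parseval for the marginal on [L]: agreement on [L] is the normalized sum of the characters
    supported there. *)
Lemma sum_agree_bias L : uniq L ->
  N ^+ size L * \sum_(f : {ffun G -> G}) \sum_(g : {ffun G -> G} | map g L == map f L) bias f * bias g =
  \sum_(psi | (supp psi \subset [set i in L]) && (psi != [ffun=> 0])) fhat psi ^+ 4.
Proof.
move=> u; have agree f g : (map g L == map f L)%:R * N ^+ size L =
    \sum_(psi : {ffun G -> G} | supp psi \subset [set i in L]) wave psi f * wave psi g.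
  have := sum_prod_chi chi [set i in L] (fun i => f i + g i) => /(congr1 (intmul (1 : R))).
  rewrite rmorph_sum /= => e.
  rewrite (eq_bigr (fun psi : {ffun G -> G} => (\prod_i chi (psi i) (f i + g i))%:~R)); last first.
    move=> psi _; rewrite rmorph_prod /= -big_split /=; apply: eq_bigr => i _.
    by rewrite chiDr rmorphM.
  rewrite e.
  have -> : [forall i in [set i in L], f i + g i == 0] = (map g L == map f L).
    apply/'forall_implyP/eqP => [h|/eq_in_map h i].
      apply/eq_in_map => i iL; have := h i; rewrite inE iL => /(_ isT) /eqP e2.
      by apply: (addrI (f i)); rewrite e2 (char_two chi).
    by rewrite inE => /h ->; rewrite (char_two chi).
  have -> : #|[set i in L]| = size L by rewrite cardsE; apply/card_uniqP.
  by case: eqP => _; rewrite ?mul0r // mul1r rmorphXn /= rmorph_nat.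
rewrite mulr_sumr.
rewrite (eq_bigr (fun f => \sum_g \sum_(psi : {ffun G -> G} | supp psi \subset [set i in L])
   (bias f * wave psi f) * (bias g * wave psi g))) => [|f _]; last first.
  rewrite mulr_sumr big_mkcond /=; apply: eq_bigr => g _.
  rewrite (eq_bigr (fun psi => (bias f * bias g) * (wave psi f * wave psi g))) => [|psi _]; last by rewrite mulrACA.
  rewrite -mulr_sumr -agree; case: eqP => _; rewrite ?mul0r ?mulr0 // mul1r mulrC //.
transitivity (\sum_(psi : {ffun G -> G} | supp psi \subset [set i in L])
  (\sum_(f : {ffun G -> G}) bias f * wave psi f) ^+ 2).
  rewrite (eq_bigr (fun f => \sum_(psi : {ffun G -> G} | supp psi \subset [set i in L])
     (bias f * wave psi f) * \sum_g bias g * wave psi g)) => [|f _].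
    by rewrite exchange_big /=; apply: eq_bigr => psi _; rewrite -mulr_suml.
  by rewrite exchange_big /=; apply: eq_bigr => psi _; rewrite mulr_sumr.
rewrite [RHS]big_mkcondr; apply: eq_bigr => psi _; rewrite bias_hat.
by case: eqP => _; rewrite ?expr0n // -exprM.
Qed.

Lemma sqr_advantage_le (t : qtree G) L : at_most_queries (size L) t -> uniq L ->
  (avg (fun pr : {perm G} * {perm G} => (run t (xor_perm pr.1 pr.2))%:R)
   - avg (fun f : {ffun G -> G} => (run t f)%:R)) ^+ 2 <=
  \sum_(psi | (supp psi \subset [set i in L]) && (psi != [ffun=> 0])) fhat psi ^+ 4.
Proof.
move=> q u; have := sqr_tree_le bias_perm q u.
by rewrite (sum_bias (fun f => (run t f)%:R)) sum_agree_bias.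
Qed.

Lemma fhat_level1 psi : #|supp psi| = 1%N -> fhat psi = 0.
Proof.
move=> k1; have := sum_sqr_fhat_supp chi R (supp psi); rewrite k1 weight_1 => /eqP.
rewrite psumr_eq0 => [|phi _]; last exact: sqr_ge0.
by move=> /allP /(_ psi (mem_index_enum _)); rewrite eqxx sqrf_eq0 => /eqP.
Qed.

(** The quotient of the binomials is the chance that a random m-set contains a given k-set. The case
    k = 2 uses n^2 <= 3 (n-1)(n-2); each further point costs a factor (m-k)/(n-k), at most
    (n-k-1)/(n-k). The factor n - k is kept because it is the multiplicity of 0. *)
Lemma bin_ratio_le n m k : (4 <= n)%N -> (m < n)%N -> (2 <= k <= n)%N ->
  (n ^ 3 * 'C(n - k, n - m) <= 3 * m ^ 2 * (n - k) * 'C(n, m))%N.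
Proof.
move=> n4 mn; elim: k => [//|k IH] /andP[k2 kn].
case: (ltnP 1 k) => k1; last first.
  have -> : k.+1 = 2%N by lia.
  case: (ltnP m 2) => m2; first by rewrite bin_small ?muln0 //; lia.
  rewrite -(bin_sub (ltnW mn)); set r := (n - m)%N.
  have e1 := mul_bin_down n r; have e2 := mul_bin_down n.-1 r.
  have n0 : (0 < n * n.-1)%N by rewrite muln_gt0; lia.
  rewrite -(leq_pmul2l n0) (_ : (n - 2 = n.-2)%N); last lia.
  have e3 : (n * n.-1 * 'C(n.-2, r) = (m * m.-1) * 'C(n, r))%N.
    have -> : (n * n.-1 * 'C(n.-2, r) = n * (n.-1 * 'C(n.-1.-1, r)))%N by rewrite mulnA.
    rewrite e2 mulnCA e1 mulnA; congr (_ * _)%N; rewrite /r.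
    have -> : (n - (n - m) = m)%N by lia.
    by have -> : (n.-1 - (n - m) = m.-1)%N; [lia | rewrite mulnC].
  rewrite (_ : (n * n.-1 * (n ^ 3 * 'C(n.-2, r)) = n ^ 3 * (n * n.-1 * 'C(n.-2, r)))%N); last by rewrite mulnCA.
  rewrite e3 mulnA [X in (_ <= X)%N]mulnA leq_mul2r; apply/orP; right.
  have h1 : (m * m.-1 <= m ^ 2)%N by rewrite -mulnn leq_mul2l leq_pred orbT.
  have h2 : (n ^ 2 <= n.-1 * (3 * n.-2))%N.
    have -> : n = (n - 4).+4 by lia.
    by move: (n - 4)%N => p /=; rewrite -mulnn; nia.
  have -> : (n * n.-1 * (3 * m ^ 2 * n.-2) = n * (n.-1 * (3 * n.-2)) * m ^ 2)%N by lia.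
  by rewrite leq_mul // expnS leq_mul2l h2 orbT.
have {}IH := IH ltac:(lia).
have e1 := mul_bin_down (n - k) (n - m).
have nk : (0 < n - k)%N by lia.
have e4 : ((n - k).-1 = n - k.+1)%N by lia.
rewrite e4 in e1; rewrite -(leq_pmul2l nk).
have -> : ((n - k) * (n ^ 3 * 'C(n - k.+1, n - m)) = n ^ 3 * ((n - k) * 'C(n - k.+1, n - m)))%N by rewrite mulnCA.
rewrite e1 mulnCA.
have h1 : (n - k - (n - m) <= n - k.+1)%N by lia.
apply: (leq_trans (leq_mul h1 IH)).
by rewrite (_ : (n - k) * (3 * m ^ 2 * (n - k.+1) * 'C(n, m)) =
  (n - k.+1) * (3 * m ^ 2 * (n - k) * 'C(n, m)))%N //; lia.
Qed.

Lemma avg_sqr_advantage_le (x : R) m : (m < #|G|)%N ->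
  (forall Q : {set G}, #|Q| = m ->
    x ^+ 2 <= \sum_(psi | (supp psi \subset Q) && (psi != [ffun=> 0])) fhat psi ^+ 4) ->
  'C(#|G|, m)%:R * x ^+ 2 <=
  \sum_(psi | psi != [ffun=> 0]) 'C(#|G| - #|supp psi|, #|G| - m)%:R * fhat psi ^+ 4.
Proof.
move=> mG h; rewrite -card_draws mulr_natl -sumr_const.
apply: (@le_trans _ _ (\sum_(Q in [set Q : {set G} | #|Q| == m])
   \sum_(psi | (supp psi \subset Q) && (psi != [ffun=> 0])) fhat psi ^+ 4)).
  by apply: ler_sum => Q; rewrite inE => /eqP; apply: h.
rewrite (exchange_big_dep (fun psi => psi != [ffun=> 0])) /=; last by move=> Q psi _ /andP[].
apply: ler_sum => psi p0; rewrite sumr_const -card_supersets_of_card; last exact: ltnW.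
rewrite mulr_natl le_eqVlt; apply/orP; left; apply/eqP; congr (_ *+ _).
apply: eq_card => Q; rewrite !inE.
by rewrite unfold_in /= inE p0 andbT andbC.
Qed.

(** Averaging over query sets brings in [bin_ratio_le], whose factor n - k is then absorbed by
    [sum_mult0_le]. *)
Lemma sqr_advantage_le_Z (x Z : R) m : (4 <= #|G|)%N -> (m < #|G|)%N ->
  (forall Q : {set G}, #|Q| = m ->
    x ^+ 2 <= \sum_(psi | (supp psi \subset Q) && (psi != [ffun=> 0])) fhat psi ^+ 4) ->
  \sum_(psi | (psi != [ffun=> 0]) && zero_mode psi) fhat psi ^+ 4 <= Z ->
  x ^+ 2 <= 3 * m%:R ^+ 2 / N ^+ 2 * Z.
Proof.
move=> G4 mG h hZ; have := avg_sqr_advantage_le mG h.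
have N0 : 0 < N by rewrite ltr0n; apply: leq_trans G4.
have c0 : 0 < 'C(#|G|, m)%:R :> R by rewrite ltr0n bin_gt0 ltnW.
have mu4 psi : 0 <= fhat psi ^+ 4 by rewrite exprn_even_ge0.
move=> h1.
have h2 : N ^+ 3 * \sum_(psi | psi != [ffun=> 0]) 'C(#|G| - #|supp psi|, #|G| - m)%:R * fhat psi ^+ 4 <=
   3 * m%:R ^+ 2 * 'C(#|G|, m)%:R * \sum_(psi | psi != [ffun=> 0]) (mult psi 0)%:R * fhat psi ^+ 4.
  rewrite !mulr_sumr; apply: ler_sum => psi p0.
  have s0 : (0 < #|supp psi|)%N.
    rewrite card_gt0; apply: contra p0 => /eqP/setP e.
    by apply/eqP/ffunP => i; have := e i; rewrite !inE ffunE => /negbFE/eqP.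
  case: (ltnP 1 #|supp psi|) => k2; last first.
    by rewrite fhat_level1 ?expr0n ?mulr0 //; apply/eqP; rewrite eqn_leq k2.
  rewrite mult0_supp [leLHS]mulrA [leRHS]mulrA ler_wpM2r //.
  rewrite -!natrX -!natrM ler_nat.
  have := @bin_ratio_le #|G| m #|supp psi| G4 mG; rewrite k2 max_card => /(_ isT).
  by move=> hb; apply: (leq_trans hb); rewrite mulnAC.
have h3 := sum_mult0_le chi R.
have h4 : N ^+ 3 * ('C(#|G|, m)%:R * x ^+ 2) <= 3 * m%:R ^+ 2 * 'C(#|G|, m)%:R * (N * Z).
  apply: (@le_trans _ _ (3 * m%:R ^+ 2 * 'C(#|G|, m)%:R *
     \sum_(psi | psi != [ffun=> 0]) (mult psi 0)%:R * fhat psi ^+ 4)).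
    by apply: le_trans h2; rewrite ler_pM2l // exprn_gt0.
  rewrite ler_wpM2l ?mulr_ge0 ?sqr_ge0 ?ler0n //; apply: (le_trans h3).
  by rewrite ler_pM2l.
have p0 : 0 < N ^+ 3 * 'C(#|G|, m)%:R by rewrite mulr_gt0 // exprn_gt0.
rewrite -(ler_pM2l p0) -[leLHS]mulrA; apply: (le_trans h4).
rewrite le_eqVlt; apply/orP; left; apply/eqP; field.
by rewrite gt_eqF.
Qed.

End SumOfPermutations.

(** * The hybrid argument *)

Section BitsPairing.
Variable d : nat.
Implicit Types a x : 'rV['F_2]_d.

Definition bits_chi a x : int := (-1) ^+ val ((a *m x^T) 0 0).

Lemma sign_F2D (u v : 'F_2) : (-1) ^+ val (u + v) = (-1) ^+ val u * (-1) ^+ val v :> int.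
Proof.
have -> : val (u + v) = ((val u + val v) %% 2)%N by [].
by rewrite modn2 signr_odd exprD.
Qed.

Lemma bits_chiC a x : bits_chi a x = bits_chi x a.
Proof. by rewrite /bits_chi !mxE; congr (_ ^+ val _); apply: eq_bigr => i _; rewrite !mxE mulrC. Qed.

Lemma bits_chiDl a b x : bits_chi (a + b) x = bits_chi a x * bits_chi b x.
Proof. by rewrite /bits_chi mulmxDl mxE sign_F2D. Qed.

Lemma bits_chiDr a x y : bits_chi a (x + y) = bits_chi a x * bits_chi a y.
Proof. by rewrite !(bits_chiC a) bits_chiDl. Qed.

Lemma bits_chi_sqr a x : bits_chi a x ^+ 2 = 1.
Proof. by rewrite /bits_chi -exprM mulnC exprM sqrrN !expr1n. Qed.

(** Translating by a basis vector on which [a] is nonzero flips every sign, so the sum equals its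
    own negative. *)
Lemma bits_chi_suml a : \sum_x bits_chi a x = if a == 0 then #|{: 'rV['F_2]_d}|%:R else 0.
Proof.
case: eqP => [->|/eqP a0].
  rewrite (eq_bigr (fun=> 1)) => [|x _]; first by rewrite sumr_const.
  by rewrite /bits_chi mul0mx mxE expr0.
have [j aj] : exists j, a 0 j != 0.
  apply/existsP; apply: contraNT a0; rewrite negb_exists => /forallP h.
  by apply/eqP/rowP => j; rewrite mxE; apply/eqP; rewrite -[_ == _]negbK.
have chi1 : bits_chi a (delta_mx 0 j) = -1.
  rewrite /bits_chi trmx_delta -colE mxE.
  by case: (a 0 j) aj => [[|[|n]] hn].
have : \sum_x bits_chi a x = - \sum_x bits_chi a x.
  rewrite {1}(reindex_inj (addIr (delta_mx 0 j))) -sumrN; apply: eq_bigr => x _.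
  by rewrite bits_chiDr chi1 mulrN1.
lia.
Qed.

Lemma bits_chi_sumr x : \sum_a bits_chi a x = if x == 0 then #|{: 'rV['F_2]_d}|%:R else 0.
Proof. by rewrite -bits_chi_suml; apply: eq_bigr => a _; apply: bits_chiC. Qed.

Lemma bits_addxx x : x + x = 0.
Proof. by apply/rowP => j; rewrite !mxE addrr_pchar2 // pchar_Fp. Qed.

Definition bits_pairing : char_pairing 'rV['F_2]_d :=
  CharPairing bits_chiDl bits_chiDr bits_chi_sqr bits_chi_suml bits_chi_sumr bits_addxx.

Lemma card_bits : #|{: 'rV['F_2]_d}| = (2 ^ d)%N.
Proof. by rewrite card_mx card_Fp // mul1n. Qed.

End BitsPairing.

Local Notation K := (500 ^+ 8)%R.

Lemma sqr_tree_advantage_le d m (t : qtree 'rV['F_2]_d) : (m < 2 ^ d)%N -> at_most_queries m t ->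
  (avg (fun pr : {perm 'rV['F_2]_d} * {perm 'rV['F_2]_d} => (run t (xor_perm pr.1 pr.2))%:R)
   - avg (fun f : {ffun 'rV['F_2]_d -> 'rV['F_2]_d} => (run t f)%:R)) ^+ 2 <=
  (3 * (3 + 2 * K)) * (m%:R ^+ 2 / 2 ^+ (3 * d)).
Proof.
set x := (X in X ^+ 2) => md tm; pose chi := bits_pairing d.
have V (Q : {set 'rV['F_2]_d}) : #|Q| = m ->
   x ^+ 2 <= \sum_(psi | (supp psi \subset Q) && (psi != [ffun=> 0])) fhat chi R psi ^+ 4.
  move=> Qm; have := @sqr_advantage_le _ chi t (enum Q); rewrite -cardE Qm enum_uniq => /(_ tm isT).
  by rewrite set_enum.
have K0 : 20 <= K :> R by lra.
move: K0 (@poly_mul_geometric_bound R); move: K => k k20 decay.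
have c0 : 0 <= 3 * (3 + 2 * k) * (m%:R ^+ 2 / 2 ^+ (3 * d)).
  by rewrite mulr_ge0 ?divr_ge0 ?exprn_ge0 ?ler0n //; lra.
(* The group order is a multiple of 4 only for d at least 2. For smaller d there is at most one
   query, and level 1 coefficients vanish. *)
have [d2|d2] := leqP 2 d; last first.
  have m1 : (m <= 1)%N by case: d d2 md {t tm x V chi c0} => [|[|d]] //; rewrite ?expn0 ?expn1; lia.
  have mN : (m <= #|{: 'rV['F_2]_d}|)%N by rewrite card_bits ltnW.
  have [Q Qm] : exists Q : {set 'rV['F_2]_d}, #|Q| = m.
    have : (0 < #|[set Q : {set 'rV['F_2]_d} | #|Q| == m]|)%N by rewrite card_draws bin_gt0.
    by move=> /card_gt0P[Q]; rewrite inE => /eqP h; exists Q.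
  apply: (le_trans (V Q Qm)); rewrite big1 // => psi /andP[/subset_leq_card sQ p0].
  rewrite (@fhat_level1 _ chi) ?expr0n //; apply/eqP; rewrite eqn_leq (leq_trans sQ) ?Qm //=.
  rewrite card_gt0; apply: contra p0 => /eqP/setP e.
  by apply/eqP/ffunP => i; have := e i; rewrite !inE ffunE => /negbFE/eqP.
pose q := (2 ^ (d - 2))%N.
have q0 : (0 < q)%N by rewrite expn_gt0.
have Nq : #|{: 'rV['F_2]_d}| = (4 * q)%N.
  by rewrite card_bits -[4%N]/(2 ^ 2)%N -expnD subnKC.
have Z := @fourth_moment_le _ chi R q q0 Nq k k20 decay.
have N4 : (4 <= #|{: 'rV['F_2]_d}|)%N by rewrite Nq; lia.
have mN : (m < #|{: 'rV['F_2]_d}|)%N by rewrite card_bits.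
have := sqr_advantage_le_Z N4 mN V Z; move/le_trans; apply.
have e : (4 * q)%:R = 2 ^+ d :> R by rewrite -Nq card_bits natrX.
rewrite Nq e mulnC exprM; have : 2 ^+ d != 0 :> R by rewrite expf_neq0 // pnatr_eq0.
set n : R := 2 ^+ d => n0; rewrite le_eqVlt; apply/orP; left; apply/eqP; field.
exact: n0.
Qed.

(** * Replacing the two keyed permutations one at a time *)

Section Hybrid.

Fixpoint shift_tree (D : zmodType) (h : D -> D) (t : qtree D) : qtree D :=
  match t with
  | Leaf b => Leaf b
  | Query x k => Query x (fun y => shift_tree h (k (y + h x)))
  end.

Lemma run_shift_tree (D : zmodType) (h g : D -> D) t :
  run (shift_tree h t) g = run t (fun x => g x + h x).
Proof. by elim: t => [//|x k IH] /=; rewrite IH. Qed.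

Lemma at_most_queries_shift (D : zmodType) (h : D -> D) m t :
  at_most_queries m t -> at_most_queries m (shift_tree h t).
Proof. by elim: t m => [//|x k IH] [//|m] /= q y; apply: IH. Qed.

Variables (D : finZmodType) (m : nat).
Implicit Types A : distinguisher D.

(** The reduction samples one summand itself, on an enlarged tape, and spends queries only on the
    other. The key type is arbitrary so that the sampled summand may also be a random
    permutation. *)
Definition shift_dist (K : finType) (h : K -> D -> D) A : distinguisher D :=
  @Distinguisher D (tape A * K)%type (fun wk => mu A wk.1 / #|K|%:R)
    (fun wk => shift_tree (h wk.2) (strat A wk.1)).

Lemma accPE A (g : D -> D) : accP A g = \sum_(w : tape A) mu A w * (run (strat A w) g)%:R.
Proof. by []. Qed.

Lemma valid_shift_dist (K : finType) (h : K -> D -> D) A : (0 < #|K|)%N ->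
  valid_dist m A -> valid_dist m (shift_dist h A).
Proof.
move=> K0 [A0 [A1 Aq]]; split=> [[w k]|]; first by rewrite /= divr_ge0 ?ler0n.
split=> [|[w k]]; last exact: at_most_queries_shift.
rewrite -(pair_bigA _ (fun w (k : K) => mu A w / #|K|%:R)) /= -[RHS]A1; apply: eq_bigr => w _.
by rewrite sumr_const -[LHS]mulr_natr mulfVK // pnatr_eq0 -lt0n.
Qed.

Lemma accP_shift_dist (K : finType) (h : K -> D -> D) A g :
  accP (shift_dist h A) g = avg (fun k => accP A (fun x => g x + h k x)).
Proof.
rewrite avgE mulr_suml; under [RHS]eq_bigr => k _ do rewrite accPE mulr_suml.
rewrite exchange_big pair_bigA; apply: eq_bigr => -[w k] _ /=.
by rewrite run_shift_tree mulrAC.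
Qed.

Lemma accP_ext A (g h : D -> D) : g =1 h -> accP A g = accP A h.
Proof. by move=> gh; rewrite !accPE; apply: eq_bigr => w _; rewrite (run_ext _ gh). Qed.

Lemma accP_bounds A (g : D -> D) : valid_dist m A -> 0 <= accP A g <= 1.
Proof.
move=> [A0 [A1 _]]; rewrite accPE; apply/andP; split.
  by apply: sumr_ge0 => w _; rewrite mulr_ge0 ?ler0n.
rewrite -[leRHS]A1; apply: ler_sum => w _; rewrite -[leRHS]mulr1 ler_wpM2l //.
by case: (run _ _).
Qed.

Lemma avg_bounds (T : finType) (f : T -> R) : (forall t, 0 <= f t <= 1) -> 0 <= avg f <= 1.
Proof.
move=> h; rewrite avgE; apply/andP; split.
  by rewrite divr_ge0 ?ler0n ?sumr_ge0 // => t _; case/andP: (h t).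
case: (posnP #|T|) => [->|T0]; first by rewrite invr0 mulr0.
rewrite ler_pdivrMr ?ltr0n // mul1r -sumr_const; apply: ler_sum => t _; by case/andP: (h t).
Qed.

Lemma advPRP_le1 (K : finType) (E : K -> D -> D) A : valid_dist m A -> advPRP E A <= 1.
Proof.
move=> vA; rewrite /advPRP.
have /andP[a0 a1] := @avg_bounds K (fun s => accP A (E s)) (fun s => accP_bounds _ vA).
have /andP[b0 b1] := @avg_bounds {perm D} (fun p => accP A p) (fun s => accP_bounds _ vA).
by rewrite ler_norml; apply/andP; split; lra.
Qed.

Lemma advPRP_le_AdvPRP (K : finType) (E : K -> D -> D) A :
  valid_dist m A -> advPRP E A <= AdvPRP E m.
Proof.
move=> vA; apply: ub_le_sup; last by exists A.
by exists 1 => _ [B [vB ->]]; apply: advPRP_le1 vB.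
Qed.

Lemma AdvPRF_le (K : finType) (F : K -> D -> D) (c : R) :
  (forall A, valid_dist m A -> advPRF F A <= c) -> AdvPRF F m <= c.
Proof.
move=> h; apply: ge_sup; last by move=> _ [A [vA ->]]; apply: h.
(* A constant distinguisher shows that the supremum is over a nonempty set. *)
pose A := @Distinguisher D unit (fun=> 1) (fun=> Leaf true).
have sum1 : \sum_(w : unit) 1 = 1 :> R by rewrite sumr_const card_unit.
exists (advPRF F A), A; split=> //; split=> [w|]; first exact: ler01.
by split=> [|w]; [exact: sum1 | case: (m)].
Qed.

Lemma avg_pair (S T : finType) (f : S -> T -> R) :
  avg (fun st : S * T => f st.1 st.2) = avg (fun s => avg (f s)).
Proof.
rewrite !avgE card_prod natrM invfM -(pair_bigA _ f) mulrCA mulrC -mulr_suml; congr (_ / _).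
Qed.

Lemma avg_exchange (S T : finType) (f : S -> T -> R) :
  avg (fun s => avg (f s)) = avg (fun t => avg (f^~ t)).
Proof.
rewrite !avgE; under eq_bigr do rewrite avgE; under [in RHS]eq_bigr do rewrite avgE.
by rewrite -!mulr_suml exchange_big /= mulrAC.
Qed.

Lemma eq_avg (T : finType) (f g : T -> R) : f =1 g -> avg f = avg g.
Proof. by move=> fg; rewrite !avgE; congr (_ / _); apply: eq_bigr => t _; apply: fg. Qed.

(** The hybrids are E + E, p + E and p + r. The first change simulates the second keyed summand, the
    other one the random permutation already in place. *)
Lemma advPRF_xor_le (K : finType) (E : K -> D -> D) A : (0 < #|K|)%N -> valid_dist m A ->
  advPRF (fun (s : K * K) x => E s.1 x + E s.2 x) A <= 2 * AdvPRP E m +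
  `| avg (fun pr : {perm D} * {perm D} => accP A (xor_perm pr.1 pr.2)) -
     avg (fun f : {ffun D -> D} => accP A f) |.
Proof.
move=> K0 vA; pose h (p : {perm D}) : D -> D := p.
have P0 : (0 < #|{perm D}|)%N by rewrite card_perm_type fact_gt0.
have a1 := advPRP_le_AdvPRP E (valid_shift_dist E K0 vA).
have a2 := advPRP_le_AdvPRP E (valid_shift_dist h P0 vA).
pose H2 := avg (fun p : {perm D} => avg (fun s => accP A (fun x => p x + E s x))).
have e1 : advPRP E (shift_dist E A) =
   `|avg (fun s : K * K => accP A (fun x => E s.1 x + E s.2 x)) - H2|.
  rewrite /advPRP (avg_pair (fun s1 s2 => accP A (fun x => E s1 x + E s2 x))).
  by congr `|_ - _|; apply: eq_avg => s; rewrite accP_shift_dist.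
have e2 : advPRP E (shift_dist h A) =
   `|H2 - avg (fun pr : {perm D} * {perm D} => accP A (xor_perm pr.1 pr.2))|.
  have -> : H2 = avg (fun s => avg (fun p : {perm D} => accP A (fun x => p x + E s x))).
    exact: avg_exchange.
  rewrite /advPRP (avg_pair (fun p r => accP A (xor_perm p r))).
  congr `|_ - _|; apply: eq_avg => s; rewrite accP_shift_dist; apply: eq_avg => p.
    by apply: accP_ext => x; rewrite /h addrC.
  by apply: accP_ext => x; rewrite ffunE.
rewrite e1 in a1; rewrite e2 in a2; move: a1 a2; rewrite /advPRF.
set x1 := avg _; set x3 := avg _; set x4 := avg _ => a1 a2.
have -> : x1 - x4 = (x1 - H2) + (H2 - x3) + (x3 - x4) by ring.
apply: le_trans (ler_normD _ _) _; rewrite lerD2r.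
apply: le_trans (ler_normD _ _) _; lra.
Qed.

Lemma avg_accP (T : finType) A (F : T -> D -> D) :
  avg (fun t => accP A (F t)) =
  \sum_(w : tape A) mu A w * avg (fun t => (run (strat A w) (F t))%:R).
Proof.
rewrite avgE; under eq_bigr => t _ do rewrite accPE.
rewrite exchange_big mulr_suml; apply: eq_bigr => w _.
by rewrite avgE mulrA mulr_sumr.
Qed.

End Hybrid.

Theorem theorem8p1 :
  exists C : R, 0 <= C /\
  forall (k d : nat) (E : bits k -> bits d -> bits d),
    (forall s, bijective (E s)) ->
    forall m : nat, (m < 2 ^ d)%N ->
      AdvPRF (xorF E) m <=
      2 * AdvPRP E m + C * (m%:R / Num.sqrt (2 ^+ (3 * d))).
Proof.
(* The tree bound is on squares, so C^2 must dominate its constant t; C = 1 + t works. *)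
have [C [C0 CK]] : exists C : R, 0 <= C /\ 3 * (3 + 2 * K) <= C ^+ 2.
  have : 0 <= K :> R by apply: exprn_ge0.
  move: K => y y0; exists (1 + 3 * (3 + 2 * y))%R; split; first lra.
  nra.
exists C; split=> // k d E _ m md.
have s0 : 0 < Num.sqrt (2 ^+ (3 * d)) :> R by rewrite sqrtr_gt0 exprn_gt0.
set beta := C * _.
have b0 : 0 <= beta by rewrite mulr_ge0 // divr_ge0 ?ler0n // ltW.
apply: AdvPRF_le => A vA.
have K1 : (0 < #|bits k|)%N by apply/card_gt0P; exists 0.
apply: (le_trans (advPRF_xor_le E K1 vA)); rewrite lerD2l.
have [A0 [A1 Aq]] := vA.
rewrite (avg_accP A (fun pr : {perm bits d} * {perm bits d} => xor_perm pr.1 pr.2)).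
rewrite (avg_accP A (fun f : {ffun bits d -> bits d} => f)) -sumrB.
apply: (le_trans (ler_norm_sum _ _ _)).
(* The bound for deterministic trees holds for every tape, hence on average over tapes. *)
apply: (@le_trans _ _ (\sum_(w : tape A) mu A w * beta)); last by rewrite -mulr_suml A1 mul1r.
apply: ler_sum => w _; rewrite -mulrBr normrM (ger0_norm (A0 w)) ler_wpM2l //.
rewrite -(ger0_norm b0) -ler_sqr ?nnegrE // !real_normK ?num_real //.
apply: le_trans (sqr_tree_advantage_le md (Aq w)) _.
rewrite /beta exprMn expr_div_n sqr_sqrtr ?exprn_ge0 //.
by rewrite ler_wpM2r ?divr_ge0 ?exprn_ge0 ?ler0n.
Qed.
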